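(* Let $(M,J,\langle\cdot,\cdot\rangle)$ be an almost Hermitian manifold of dimension $2n$, $n>1$, with Kähler form $\omega$, Lee form $\theta$, intrinsic torsion $\xi=\xi_{(1)}+\xi_{(2)}+\xi_{(3)}+\xi_{(4)}$ and minimal connection $\nabla^{U(n)}$. Then, for all vector fields $X,Y$, $$(d\theta)_{\mathbb{R}\omega}=0,$$ $$\begin{aligned}\tfrac{n-2}{2}(d\theta)_{[\lambda_0^{1,1}]}(X,Y)=&-\langle(\nabla^{U(n)}_{e_i}\xi_{(3)})_XY,e_i\rangle+\langle(\nabla^{U(n)}_{e_i}\xi_{(3)})_YX,e_i\rangle+\tfrac{n-2}{2}\langle\xi_{(3)X}Y-\xi_{(3)Y}X,\theta^\sharp\rangle\\&-\tfrac32\langle\xi_{(1)X}e_i,\xi_{(2)Y}e_i\rangle+\tfrac32\langle\xi_{(1)Y}e_i,\xi_{(2)X}e_i\rangle,\end{aligned}$$ $$\begin{aligned}\tfrac{n-2}{2}(d\theta)_{[[\lambda^{2,0}]]}(X,Y)=&-3\langle(\nabla^{U(n)}_{e_i}\xi_{(1)})_{e_i}X,Y\rangle+\langle(\nabla^{U(n)}_{e_i}\xi_{(3)})_{e_i}X,Y\rangle+\langle\xi_{(3)X}e_i,\xi_{(1)Y}e_i\rangle-\langle\xi_{(3)Y}e_i,\xi_{(1)X}e_i\rangle\\&-\tfrac12\langle\xi_{(3)X}e_i,\xi_{(2)Y}e_i\rangle+\tfrac12\langle\xi_{(3)Y}e_i,\xi_{(2)X}e_i\rangle+\tfrac{3(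n-3)}{2}\langle\xi_{(1)\theta^\sharp}X,Y\rangle-\tfrac{n-1}{2}\langle\xi_{(3)\theta^\sharp}X,Y\rangle.\end{aligned}$$
   Context: An almost Hermitian manifold is a smooth $2n$-manifold with an almost complex structure $J$ ($J^2=-I$) and a Riemannian metric with $\langle JX,JY\rangle=\langle X,Y\rangle$. Kähler form: $\omega(X,Y)=\langle X,JY\rangle$. $\nabla$ is the Levi-Civita connection. The intrinsic torsion is the $(1,2)$-tensor $\xi_X=-\tfrac12 J\circ\nabla_XJ$, i.e. $\xi_XY=-\tfrac12J(\nabla_XJ)Y$; each $\xi_X$ is skew-symmetric and anticommutes with $J$. The minimal connection is $\nabla^{U(n)}=\nabla+\xi$ (it is a metric connection with $\nabla^{U(n)}J=0$). Let $\mathcal W$ be the space (bundle) of $(1,2)$-tensors $\xi$ with each $\xi_X$ skew-symmetric and $J\xi_X+\xi_XJ=0$. It decomposes orthogonally as $\mathcal W=\mathcal W_1\oplus\mathcal W_2\oplus\mathcal W_3\oplus\mathcal W_4$ (Gray–Hervella), where: $\mathcal W_1$: $\xi_XX=0$ for all $X$; $\mathcal W_2$: the cyclic sum over $X,Y,Z$ of $\langle\xi_XY,JZ\rangle$ vanishes; $\mathcal W_3$: $\xi_{JX}JY=\xi_XY$ and $\sum_i\xi_{e_i}e_i=0$; $\mathcal W_4$: tensors of the form $4\xi_XY=\langle X,Y\rangle\theta^\sharp-\theta(Y)X-\langle JX,Y\rangle J\theta^\sharp+(J\theta)(Y)JX$ for a one-form $\theta$. For $n=2$, $\mathcal W_1=\mathcal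 W_3=0$. $\xi_{(a)}$ is the component of $\xi$ in $\mathcal W_a$. For a one-form $a$: $(Ja)(X)=-a(JX)$, and $a^\sharp$ is its metric dual vector field. Lee form: $\theta=-\tfrac1{n-1}Jd^*\omega$, where $d^*$ is the codifferential; equivalently $\sum_i\xi_{e_i}e_i=\tfrac{n-1}2\theta^\sharp$, and $\xi_{(4)}$ is given by the formula above with this $\theta$. $\{e_1,\dots,e_{2n}\}$ is a local orthonormal frame, and a repeated index $i$ means summation from $1$ to $2n$. $d\theta(X,Y)=(\nabla_X\theta)(Y)-(\nabla_Y\theta)(X)$. For two-forms, $\langle\alpha,\beta\rangle=\tfrac12\sum_{i,j}\alpha(e_i,e_j)\beta(e_i,e_j)$. Components of a two-form $\alpha$: $\alpha_{\mathbb R\omega}=\tfrac1n\langle\alpha,\omega\rangle\omega$; $\alpha_{[\lambda^{1,1}]}(X,Y)=\tfrac12(\alpha(X,Y)+\alpha(JX,JY))$; $\alpha_{[\lambda^{1,1}_0]}=\alpha_{[\lambda^{1,1}]}-\alpha_{\mathbb R\omega}$; $\alpha_{[[\lambda^{2,0}]]}(X,Y)=\tfrac12(\alpha(X,Y)-\alpha(JX,JY))$. *)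

(* Defs.v *)
From HB Require Import structures.
From mathcomp Require Import all_boot all_order all_algebra.
From mathcomp Require Import all_classical all_reals all_analysis.

Set Implicit Arguments.
Unset Strict Implicit.
Unset Printing Implicit Defensive.

Import Order.TTheory GRing.Theory Num.Theory.
Import numFieldNormedType.Exports.

Local Open Scope classical_set_scope.
Local Open Scope ring_scope.

(** Smooth functions on an open set [V] (of a finite-dimensional space): all
    iterated directional derivatives along constant vectors exist and are
    continuous on [V]. The values of [f] outside [V] are irrelevant. *)

Fixpoint Ck_on (R : realType) (U W : normedModType R) (V : set U) (k : nat)
    (f : U -> W) : Prop :=
  (forall x, V x -> {for x, continuous f}) /\
  match k with
  | 0%N => True
  | k'.+1 => forall v, (forall x, V x -> derivable f x v) /\
                       Ck_on V k' ('D_v f)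
  end.

Definition smooth_on (R : realType) (U W : normedModType R) (V : set U)
    (f : U -> W) : Prop := forall k, Ck_on V k f.

Record smoothManifold (R : realType) (m : nat) := SmoothManifold {
  carrier :> topologicalType;
  chart : Type;
  dom : chart -> set carrier;
  cmap : chart -> carrier -> 'rV[R]_m;
  cinv : chart -> 'rV[R]_m -> carrier;
  manifold_hausdorff : hausdorff_space carrier;
  manifold_second_countable : @second_countable carrier;
  chart_cover : forall p, exists a, dom a p;
  dom_open : forall a, open (dom a);
  img_open : forall a, open (cmap a @` dom a);
  cmapK : forall a p, dom a p -> cinv a (cmap a p) = p;
  cmap_continuous : forall a p, dom a p -> {for p, continuous (cmap a)};
  cinv_continuous : forall a x, (cmap a @` dom a) x ->
    {for x, continuous (cinv a)};
  trans_smooth : forall a b,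
    smooth_on (cmap a @` (dom a `&` dom b)) (cmap b \o cinv a) }.

Section Tensors.
Context (R : realType) (m : nat) (M : smoothManifold R m).
Local Notation E := 'rV[R]_m.
Local Notation chart := (chart M).

Definition img (a : chart) (W : set M) : set E := cmap a @` (dom a `&` W).
Definition trans (a b : chart) : E -> E := cmap b \o cinv a.
Definition push (a b : chart) (x v : E) : E := 'D_v (trans a b) x.

(** A tensor field is the family of its expressions in the charts, smooth and
    compatible with the changes of coordinates: in the chart [a], [X a x] is the
    vector of components at the point with coordinates [x], and tensors act on
    such vectors by multilinear maps. Only the values at [x] in the image of the
    chart [a] matter. *)

Definition vfield := chart -> E -> E.
Definition field01 := chart -> E -> E -> R.
Definition field02 := chart -> E -> E -> E -> R.
Definition field11 := chart -> E -> E -> E.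
Definition field12 := chart -> E -> E -> E -> E.

Definition bilin (V : lmodType R) (f : E -> E -> V) : Prop :=
  (forall u, linear (f u)) /\ (forall v, linear (f ^~ v)).

Definition is_vector_field (W : set M) (X : vfield) : Prop :=
  (forall a, smooth_on (img a W) (X a)) /\
  (forall a b x, img a (dom b `&` W) x ->
     X b (trans a b x) = push a b x (X a x)).

Definition is_one_form (th : field01) : Prop :=
  [/\ forall a x, img a setT x -> linear (th a x),
      forall a v, smooth_on (img a setT) (fun x => th a x v)
    & forall a b x v, img a (dom b) x ->
        th b (trans a b x) (push a b x v) = th a x v].

Definition is_tensor02 (b : field02) : Prop :=
  [/\ forall a x, img a setT x -> bilin (b a x),
      forall a u v, smooth_on (img a setT) (fun x => b a x u v)
    & forall a c x u v, img a (dom c) x ->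
        b c (trans a c x) (push a c x u) (push a c x v) = b a x u v].

Definition is_tensor11 (T : field11) : Prop :=
  [/\ forall a x, img a setT x -> linear (T a x),
      forall a v, smooth_on (img a setT) (fun x => T a x v)
    & forall a b x v, img a (dom b) x ->
        T b (trans a b x) (push a b x v) = push a b x (T a x v)].

Definition is_tensor12 (T : field12) : Prop :=
  [/\ forall a x, img a setT x -> bilin (T a x),
      forall a u v, smooth_on (img a setT) (fun x => T a x u v)
    & forall a b x u v, img a (dom b) x ->
        T b (trans a b x) (push a b x u) (push a b x v) =
        push a b x (T a x u v)].

(** An affine connection is given by its Christoffel symbols
    [G a x u v = Gamma^k_ij u^i v^j]; the derivative of a vector field is then
    [nabla_u Y = 'D_u Y x + G a x u (Y x)]. *)
Definition is_connection (G : field12) : Prop :=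
  [/\ forall a x, img a setT x -> bilin (G a x),
      forall a u v, smooth_on (img a setT) (fun x => G a x u v)
    & forall a b x u v, img a (dom b) x ->
        push a b x (G a x u v) =
        'D_u (fun y => push a b y v) x
        + G b (trans a b x) (push a b x u) (push a b x v)].

(** Covariant derivatives of tensor fields, in the usual coordinate form
    (the arguments [v], [w] being extended as constant fields in the chart):
    [cov12 G T a x u v w] is [(nabla_u T)_v w]. *)
Definition cov01 (G : field12) (th : field01) a (x u v : E) : R :=
  'D_u (fun y => th a y v) x - th a x (G a x u v).

Definition cov02 (G : field12) (b : field02) a (x u v w : E) : R :=
  'D_u (fun y => b a y v w) x - b a x (G a x u v) w - b a x v (G a x u w).

Definition cov11 (G : field12) (T : field11) a (x u v : E) : E :=
  'D_u (fun y => T a y v) x + G a x u (T a x v) - T a x (G a x u v).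

Definition cov12 (G : field12) (T : field12) a (x u v w : E) : E :=
  'D_u (fun y => T a y v w) x + G a x u (T a x v w)
  - T a x (G a x u v) w - T a x v (G a x u w).

Definition dform (G : field12) (th : field01) : field02 :=
  fun a x u v => cov01 G th a x u v - cov01 G th a x v u.

Definition is_levi_civita (g : field02) (G : field12) : Prop :=
  [/\ is_connection G,
      forall a x u v, img a setT x -> G a x u v = G a x v u
    & forall a x u v w, img a setT x -> cov02 G g a x u v w = 0].

End Tensors.

Record almostHermitian (R : realType) (n : nat) := AlmostHermitian {
  ah_manifold :> smoothManifold R n.*2;
  metric : field02 ah_manifold;
  acs : field11 ah_manifold;
  metric_tensor : is_tensor02 metric;
  metric_sym : forall a x u v, img a setT x ->
    metric a x u v = metric a x v u;
  metric_posdef : forall a x u, img a setT x -> u != 0 -> 0 < metric a x u u;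
  acs_tensor : is_tensor11 acs;
  acs_sqr : forall a x v, img a setT x -> acs a x (acs a x v) = - v;
  metric_acs : forall a x u v, img a setT x ->
    metric a x (acs a x u) (acs a x v) = metric a x u v }.

Section AlmostHermitian.
Context (R : realType) (n : nat) (M : almostHermitian R n).
Local Notation E := 'rV[R]_(n.*2).
Local Notation chart := (chart M).
Local Notation g := (@metric R n M).
Local Notation J := (@acs R n M).

Definition kahler : field02 M := fun a x u v => g a x u (J a x v).

Definition orthonormal a (x : E) (e : 'I_(n.*2) -> E) : Prop :=
  forall i j, g a x (e i) (e j) = (i == j)%:R.

Definition is_orthonormal_frame (W : set M) (e : 'I_(n.*2) -> vfield M) : Prop :=
  (forall i, is_vector_field W (e i)) /\
  (forall a x, img a W x -> orthonormal a x (fun i => e i a x)).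

Definition intrinsic_torsion (G : field12 M) : field12 M :=
  fun a x u v => - 2^-1 *: J a x (cov11 G J a x u v).

Definition minimal_connection (G : field12 M) : field12 M :=
  fun a x u v => G a x u v + intrinsic_torsion G a x u v.

Definition Jform a (x : E) (al : E -> R) : E -> R := fun v => - al (J a x v).

(** Codifferential of a two-form, computed in an orthonormal basis [e] of the
    tangent space at [x]. *)
Definition codiff (G : field12 M) (b : field02 M) a (x : E)
    (e : 'I_(n.*2) -> E) : E -> R :=
  fun v => - \sum_i cov02 G b a x (e i) (e i) v.

Definition is_lee_form (G : field12 M) (th : field01 M) : Prop :=
  is_one_form th /\
  forall a x e v, img a setT x -> orthonormal a x e ->
    th a x v = - (n%:R - 1)^-1 * Jform a x (codiff G kahler a x e) v.

Definition is_sharp (th : field01 M) (ths : vfield M) : Prop :=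
  is_vector_field setT ths /\
  forall a x v, img a setT x -> g a x (ths a x) v = th a x v.

Definition in_W a (x : E) (T : E -> E -> E) : Prop :=
  [/\ bilin T,
      forall u v w, g a x (T u v) w = - g a x v (T u w)
    & forall u v, J a x (T u v) + T u (J a x v) = 0].

Definition in_W1 a (x : E) (T : E -> E -> E) : Prop :=
  in_W a x T /\ forall u, T u u = 0.

Definition in_W2 a (x : E) (T : E -> E -> E) : Prop :=
  in_W a x T /\ forall u v w,
    g a x (T u v) (J a x w) + g a x (T v w) (J a x u)
    + g a x (T w u) (J a x v) = 0.

Definition in_W3 a (x : E) (T : E -> E -> E) : Prop :=
  [/\ in_W a x T,
      forall u v, T (J a x u) (J a x v) = T u v
    & forall e, orthonormal a x e -> \sum_i T (e i) (e i) = 0].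

Definition in_W4 a (x : E) (T : E -> E -> E) : Prop :=
  in_W a x T /\ exists (th : E -> R) (ths : E),
    (forall v, g a x ths v = th v) /\
    forall u v, 4 *: T u v =
      g a x u v *: ths - th v *: u - g a x (J a x u) v *: J a x ths
      + Jform a x th v *: J a x u.

(** [xi1], ..., [xi4] are the components of the intrinsic torsion in the
    Gray-Hervella spaces; as these are in direct sum, the components are
    determined by the conditions below. *)
Definition is_torsion_decomposition (G xi1 xi2 xi3 xi4 : field12 M) : Prop :=
  [/\ is_tensor12 xi1, is_tensor12 xi2, is_tensor12 xi3, is_tensor12 xi4
    & forall a x, img a setT x ->
        [/\ in_W1 a x (xi1 a x), in_W2 a x (xi2 a x),
            in_W3 a x (xi3 a x), in_W4 a x (xi4 a x)
          & forall u v, intrinsic_torsion G a x u v =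
              xi1 a x u v + xi2 a x u v + xi3 a x u v + xi4 a x u v]].

(** Components of a two-form [al] at the point with coordinates [x]; [e] is an
    orthonormal basis of the tangent space there. *)

Definition form2_inner (e : 'I_(n.*2) -> E) (al be : E -> E -> R) : R :=
  2^-1 * \sum_i \sum_j al (e i) (e j) * be (e i) (e j).

Definition comp_Romega a (x : E) e (al : E -> E -> R) : E -> E -> R :=
  fun u v => n%:R^-1 * form2_inner e al (kahler a x) * kahler a x u v.

Definition comp_11 a (x : E) (al : E -> E -> R) : E -> E -> R :=
  fun u v => 2^-1 * (al u v + al (J a x u) (J a x v)).

Definition comp_110 a (x : E) e (al : E -> E -> R) : E -> E -> R :=
  fun u v => comp_11 a x al u v - comp_Romega a x e al u v.

Definition comp_20 a (x : E) (al : E -> E -> R) : E -> E -> R :=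
  fun u v => 2^-1 * (al u v - al (J a x u) (J a x v)).

End AlmostHermitian.

(* Main.v *)
(**
In a chart the three-form [d omega] is [2] times the cyclic sum of
[<xi_X Y, J Z>]; the component of [xi] in W2 drops out and the one in W4
contributes [theta /\ omega]. Write [d (d omega) = 0] with the minimal
connection, whose torsion is [xi_X Y - xi_Y X], and contract the resulting
four-form with [omega]. Since the minimal connection preserves the metric, [J]
and each Gray-Hervella class, this is an equation
  [(n - 2) / 2 d theta + 1 / 2 <d theta, omega> omega = R11 + R20],
where [R11] and [R20] are the right-hand sides of the theorem, of type [(1,1)]
and [(2,0) + (0,2)]. Contracting once more with [omega] kills [R11], because W1
and W2 are orthogonal, and gives [(n - 1) <d theta, omega> = 0].
*)
Require Import Defs.
From HB Require Import structures.
From mathcomp Require Import all_boot all_order all_algebra.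
From mathcomp Require Import all_classical all_reals all_analysis.
From mathcomp Require Import ring lra.

Set Implicit Arguments.
Unset Strict Implicit.
Unset Printing Implicit Defensive.

Import Order.TTheory GRing.Theory Num.Theory.
Import numFieldNormedType.Exports.

Local Open Scope classical_set_scope.
Local Open Scope ring_scope.

(** * Directional derivatives *)

(** [smooth_on] speaks only of derivatives along constant vectors. That such a derivative is linear
    in the direction, and that second derivatives commute, is therefore derived from the mean value
    theorem; commutation is what makes [d (d omega) = 0] in a chart, where constant fields have no
    brackets. Everything at a single point is algebra in a vector space with [g], [J] and an
    orthonormal basis. The analysis enters it through the equation [closed] and through the fact
    that derivatives by a connection preserving [g] and [J] keep the symmetries of the fields. The
    component in W2 is absent from [d omega], so it reappears only undifferentiated, through the
    torsion; the derivative of the component in W4 is that of [theta]. The basis is not adapted to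
    [J]. Instead [J] is carried across a sum over the basis as a skew map; most cross terms vanish
    because replacing [e i] by [J (e i)] keeps the sum and changes its sign. *)

Section DirectionalDerivatives.
Context {R : realType} {U : normedModType R}.
Implicit Types (f : U -> R) (p v w x : U).

Lemma is_derive_along_line f p w (s : R) : derivable f (s *: w + p) w ->
  is_derive s 1 (fun t : R => f (t *: w + p)) ('D_w f (s *: w + p)).
Proof.
move=> df.
have E : (fun h : R => h^-1 *: (f (h *: w + (s *: w + p)) - f (s *: w + p))) =
  (fun h : R => h^-1 *: (f ((h *: 1 + s) *: w + p) - f (s *: w + p))).
  by apply/funext => h; rewrite scalerDl -addrA /GRing.scale/= mulr1.
apply: DeriveDef.
  by move: df; rewrite /derivable /= E.
by rewrite /derive /= E.
Qed.

Lemma MVT_direction f p w :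
  (forall s : R, 0 <= s <= 1 -> derivable f (s *: w + p) w) ->
  exists2 c : R, 0 <= c <= 1 & f (w + p) - f p = 'D_w f (c *: w + p).
Proof.
move=> df.
have dphi (s : R) : s \in `[0, 1]%R ->
  is_derive s 1 (fun t : R => f (t *: w + p)) ('D_w f (s *: w + p)).
  by rewrite in_itv => s01; exact/is_derive_along_line/df.
have dphi_oo (s : R) : s \in `]0, 1[%R ->
  is_derive s 1 (fun t : R => f (t *: w + p)) ('D_w f (s *: w + p)).
  by move=> /subset_itv_oo_cc; exact: dphi.
have cphi : {within `[0, 1 : R], continuous (fun t : R => f (t *: w + p))}.
  by apply: derivable_within_continuous => s /dphi[].
have [c c01 E] := MVT_segment (@ler01 R) dphi_oo cphi.
exists c; first by rewrite in_itv in c01.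
by move: E; rewrite scale1r scale0r add0r subr0 mulr1.
Qed.

(** Along the line through [x] this is the chain rule for a one-variable function composed with
    multiplication by [h], which also covers [h = 0]. *)
Lemma is_derive_scale_direction (W : normedModType R) (f : U -> W) x v (h : R) :
  derivable f x v -> is_derive x (h *: v) f (h *: 'D_v f x).
Proof.
have D (w : U) : 'D_w f x = 'D_1 (fun t : R => f (t *: w + x)) 0.
  rewrite /derive /= scale0r add0r.
  suff -> : (fun h : R => h^-1 *: (f ((h *: 1 + (0 : R)) *: w + x) - f x)) =
    (fun h : R => h^-1 *: (f (h *: w + x) - f x)) by [].
  by apply/funext => t; rewrite addr0 [_%:A]mulr1.
move=> /derivable1P/derivable1_diffP; set phi := (X in differentiable X _) => dphi.
have E : (fun t : R => f (t *: (h *: v) + x)) = phi \o ( *:%R^~ h).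
  by apply/funext => t; rewrite /phi/= scalerA.
have dpsi : differentiable (phi \o ( *:%R^~ h)) (0 : R).
  by apply: differentiable_comp => //; rewrite scale0r.
apply: DeriveDef; first by apply/derivable1P/derivable1_diffP; rewrite E.
rewrite !D E !deriveE// diff_comp//=; last by rewrite scale0r.
rewrite scale0r -linearZ/=; congr ('d phi 0 _).
by rewrite diff_val scale1r /GRing.scale/= mulr1.
Qed.

Lemma small_parallelogram x u v (P : set U) : nbhs x P ->
  exists2 h : R, 0 < h & forall s t : R, 0 <= s <= 1 -> 0 <= t <= 1 ->
    P (s *: (h *: u) + (t *: (h *: v) + x)).
Proof.
move=> /nbhs_ballP[r /= r0 rP].
have N0 : 0 < `|u| + `|v| + 1 by rewrite ltr_wpDl// addr_ge0.
(* The summand [1] keeps the denominator positive and the final estimate strict even when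
   [u = v = 0]. *)
exists (r / (`|u| + `|v| + 1)); first exact: divr_gt0.
set h := r / _; have h0 : 0 < h by exact: divr_gt0.
move=> s t /andP[s0 s1] /andP[t0 t1]; apply: rP.
rewrite -ball_normE /ball_/= addrA opprD addrCA subrr addr0 normrN.
apply: (le_lt_trans (ler_normD _ _)); rewrite (normrZ s) (normrZ t) (normrZ h u)
  (normrZ h v) (ger0_norm s0) (ger0_norm t0) (gtr0_norm h0).
have hu : s * (h * `|u|) <= h * `|u| by rewrite ler_piMl// mulr_ge0// ltW.
have hv : t * (h * `|v|) <= h * `|v| by rewrite ler_piMl// mulr_ge0// ltW.
apply: (le_lt_trans (lerD hu hv)); rewrite -mulrDr.
by rewrite /h mulrAC ltr_pdivrMr// ltr_pM2l// ltrDl ltr01.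
Qed.

Lemma continuous_near_dist (F : U -> R) x (e : R) : {for x, continuous F} ->
  0 < e -> \forall y \near x, `|F x - F y| < e.
Proof. by move=> cF e0; move/cvgrPdist_lt : cF; apply. Qed.

Lemma eq_norm_le (a b : R) : (forall e, 0 < e -> `|a - b| <= e) -> a = b.
Proof.
move=> ab; apply/eqP; rewrite -subr_eq0 -normr_le0.
by apply/ler_addgt0Pl => e e0; rewrite addr0; exact: ab.
Qed.

Lemma dist_le_of_near (a a' b b' e : R) :
  `|a - a'| < e / 2 -> `|b - b'| < e / 2 -> a' = b' -> `|a - b| <= e.
Proof.
move=> + + E; rewrite E !ltr_norml => /andP[? ?] /andP[? ?].
by rewrite ler_norml; apply/andP; split; lra.
Qed.

Lemma dist_add_le_of_near (a b c a' b' c' e : R) :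
  `|a - a'| < e / 3 -> `|b - b'| < e / 3 -> `|c - c'| < e / 3 ->
  a' = b' + c' -> `|a - (b + c)| <= e.
Proof.
move=> + + + E; rewrite E !ltr_norml => /andP[? ?] /andP[? ?] /andP[? ?].
by rewrite ler_norml; apply/andP; split; lra.
Qed.

Lemma second_difference_sym (a b c d : R) : a - b - (c - d) = a - c - (b - d).
Proof. ring. Qed.

Lemma is_derive_translate (W : normedModType R) (f : U -> W) p c w :
  derivable f (p + c) w ->
  is_derive p w (fun y => f (y + c)) ('D_w f (p + c)).
Proof.
have E : (fun h : R => h^-1 *: (f (h *: w + (p + c)) - f (p + c))) =
  (fun h : R => h^-1 *: (f (h *: w + p + c) - f (p + c))).
  by apply/funext => h; rewrite addrA.
move=> df; apply: DeriveDef; first by move: df; rewrite /derivable /= E.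
by rewrite /derive /= E.
Qed.

(** The increment of [f] along the diagonal of a small parallelogram is the sum of those along two
    edges. By the mean value theorem each is [h] times a directional derivative at a nearby point,
    and continuity at [x] concludes. *)
Lemma derive_direction_add (V : set U) f x u v :
  nbhs x V -> (forall w y, V y -> derivable f y w) ->
  (forall w, {for x, continuous ('D_w f)}) ->
  'D_(u + v) f x = 'D_u f x + 'D_v f x.
Proof.
move=> xV df cf; apply: eq_norm_le => e e0.
have e3 : 0 < e / 3 by rewrite divr_gt0.
pose near3 y := [/\ V y, `|'D_(u + v) f x - 'D_(u + v) f y| < e / 3,
  `|'D_u f x - 'D_u f y| < e / 3 & `|'D_v f x - 'D_v f y| < e / 3].
have /(small_parallelogram u v)[h h0 hP] : nbhs x near3.
  have N w := continuous_near_dist (cf w) e3.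
  apply: filterS (filterI xV (filterI (N (u + v)) (filterI (N u) (N v)))).
  by move=> y [Vy [Ny1 [Ny2 Ny3]]]; exact: And4 Vy Ny1 Ny2 Ny3.
have unit0 : 0 <= (0 : R) <= 1 by apply/andP; split; [exact: lexx|exact: ler01].
have unit1 : 0 <= (1 : R) <= 1 by apply/andP; split; [exact: ler01|exact: lexx].
have der (c d : R) w : 0 <= c <= 1 -> 0 <= d <= 1 ->
    let p := c *: (h *: u) + (d *: (h *: v) + x) in
    is_derive p (h *: w) f (h *: 'D_w f p).
  by move=> cu du; apply/is_derive_scale_direction/df; have [] := hP c d cu du.
have dir (c d : R) : 0 <= c <= 1 -> 0 <= d <= 1 ->
    let p := c *: (h *: u) + (d *: (h *: v) + x) in forall w,
    'D_(h *: w) f p = h * 'D_w f p.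
  by move=> cu du p w; have [] := der c d w cu du.
have [|c0 c0u E0] := @MVT_direction f x (h *: (u + v)).
  move=> s su; rewrite !scalerDr -addrA -scalerDr.
  by have [] := der s s (u + v) su su.
have [|c1 c1u E1] := @MVT_direction f (h *: v + x) (h *: u).
  by move=> s su; have := der s 1 u su unit1; rewrite /= scale1r => -[].
have [|c2 c2u E2] := @MVT_direction f x (h *: v).
  move=> s su; have := der 0 s v unit0 su.
  by rewrite /= scale0r add0r => -[].
have {}E1 : f (h *: u + (h *: v + x)) - f (h *: v + x) =
    h * 'D_u f (c1 *: (h *: u) + (1 *: (h *: v) + x)).
  by rewrite E1 -dir// scale1r.
have {}E2 : f (h *: v + x) - f x =
    h * 'D_v f (0 *: (h *: u) + (c2 *: (h *: v) + x)).
  by rewrite E2 -dir// scale0r add0r.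
have {}E0 : f (h *: u + (h *: v + x)) - f x =
    h * 'D_(u + v) f (c0 *: (h *: u) + (c0 *: (h *: v) + x)).
  by rewrite -dir// [in RHS]addrA -[in RHS]scalerDr -[in RHS]scalerDr -E0 scalerDr addrA.
(* The intermediate points lie on the diagonal, on the edge from [x + h v] along [u], and on the
   edge from [x] along [v]. *)
have {E0 E1 E2} E : 'D_(u + v) f (c0 *: (h *: u) + (c0 *: (h *: v) + x)) =
    'D_u f (c1 *: (h *: u) + (1 *: (h *: v) + x)) +
    'D_v f (0 *: (h *: u) + (c2 *: (h *: v) + x)).
  apply: (mulfI (lt0r_neq0 h0)); rewrite mulrDr -E0 -E1 -E2.
  by rewrite subrKA.
have [_ N0 _ _] := hP c0 c0 c0u c0u; have [_ _ N1 _] := hP c1 1 c1u unit1.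
have [_ _ _ N2] := hP 0 c2 unit0 c2u.
exact: dist_add_le_of_near N0 N1 N2 E.
Qed.

(* Two applications of the mean value theorem to the second difference of [f]
   over a small parallelogram, once in each order. *)
Lemma derive_direction_comm (V : set U) f x u v :
  open V -> V x -> (forall w y, V y -> derivable f y w) ->
  (forall w w' y, V y -> derivable ('D_w f) y w') ->
  (forall w w', {for x, continuous ('D_w' ('D_w f))}) ->
  'D_u ('D_v f) x = 'D_v ('D_u f) x.
Proof.
move=> oV Vx df ddf cf; apply: eq_norm_le => e e0.
have e2 : 0 < e / 2 by rewrite divr_gt0.
pose near2 y := [/\ V y, `|'D_u ('D_v f) x - 'D_u ('D_v f) y| < e / 2 &
  `|'D_v ('D_u f) x - 'D_v ('D_u f) y| < e / 2].
have /(small_parallelogram u v)[h h0 hP] : nbhs x near2.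
  have N w w' := continuous_near_dist (cf w w') e2.
  apply: filterS (filterI (open_nbhs_nbhs (conj oV Vx)) (filterI (N v u) (N u v))).
  by move=> y [Vy [Ny1 Ny2]]; exact: And3 Vy Ny1 Ny2.
(* The mean value theorem is applied to [y => F (y + h v') - F y] along [h u'], then to ['D_u' F]
   along [h v']. *)
have mixed (F : U -> R) u' v' : (forall w y, V y -> derivable F y w) ->
    (forall w w' y, V y -> derivable ('D_w F) y w') ->
    (forall s t : R, 0 <= s <= 1 -> 0 <= t <= 1 ->
      V (s *: (h *: u') + (t *: (h *: v') + x))) ->
    exists s t : R, [/\ 0 <= s <= 1, 0 <= t <= 1 &
      F (h *: u' + (h *: v' + x)) - F (h *: u' + x) - (F (h *: v' + x) - F x) =
      h * (h * 'D_v' ('D_u' F) (s *: (h *: u') + (t *: (h *: v') + x)))].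
  move=> dF ddF VP.
  have unit0 : 0 <= (0 : R) <= 1 by apply/andP; split; [exact: lexx|exact: ler01].
  have unit1 : 0 <= (1 : R) <= 1 by apply/andP; split; [exact: ler01|exact: lexx].
  have sh (s : R) : s *: (h *: u') + x + h *: v' = s *: (h *: u') + (1 *: (h *: v') + x).
    by rewrite scale1r -addrA [x + _]addrC.
  have d1 (s : R) : 0 <= s <= 1 -> is_derive (s *: (h *: u') + x) (h *: u')
      (fun y => F (y + h *: v') - F y)
      ('D_(h *: u') F (s *: (h *: u') + x + h *: v') - 'D_(h *: u') F (s *: (h *: u') + x)).
    move=> su.
    have V0 := VP s 0 su unit0; have V1 := VP s 1 su unit1.
    rewrite scale0r add0r in V0; rewrite -sh in V1.
    apply: is_deriveB; last first.
      by apply: derivableP; have [] := is_derive_scale_direction h (dF u' _ V0).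
    apply: is_derive_translate.
    by have [] := is_derive_scale_direction h (dF u' _ V1).
  have [|s su E1] := @MVT_direction (fun y => F (y + h *: v') - F y) x (h *: u').
    by move=> s su; have [] := d1 s su.
  have [_ D1] := d1 s su.
  have V0 := VP s 0 su unit0; have V1 := VP s 1 su unit1.
  rewrite scale0r add0r in V0; rewrite -sh in V1.
  have [_ Da] := is_derive_scale_direction h (dF u' _ V0).
  have [_ Db] := is_derive_scale_direction h (dF u' _ V1).
  have [|t tu E2] := @MVT_direction ('D_u' F) (s *: (h *: u') + x) (h *: v').
    move=> t tu; have Vt := VP s t su tu; rewrite addrCA in Vt.
    by have [] := is_derive_scale_direction h (ddF u' v' _ Vt).
  have Vt := VP s t su tu; rewrite addrCA in Vt.
  have [_ Dc] := is_derive_scale_direction h (ddF u' v' _ Vt).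
  exists s, t; split => //.
  rewrite [h *: v' + x]addrC addrA E1 D1 Da Db /GRing.scale/= -mulrBr.
  by congr (h * _); rewrite [_ + h *: v']addrC E2 Dc [in RHS]addrCA.
have [s [t [su tu E1]]] := mixed f u v df ddf
  (fun s t su tu => let: And3 Vy _ _ := hP s t su tu in Vy).
have [|s' [t' [su' tu' E2]]] := mixed f v u df ddf.
  by move=> s' t' su' tu'; rewrite addrCA; have [] := hP t' s' tu' su'.
have E : 'D_v ('D_u f) (s *: (h *: u) + (t *: (h *: v) + x)) =
    'D_u ('D_v f) (s' *: (h *: v) + (t' *: (h *: u) + x)).
  apply: (mulfI (lt0r_neq0 h0)); apply: (mulfI (lt0r_neq0 h0)).
  apply: etrans (esym E1) (etrans _ E2).
  rewrite (addrCA (h *: v) (h *: u) x); exact: second_difference_sym.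
have [_ N0 _] := hP t' s' tu' su'; have [_ _ N1] := hP s t su tu.
rewrite (addrCA (s' *: _)) in E.
exact: dist_le_of_near N0 N1 (esym E).
Qed.

End DirectionalDerivatives.

(** * Functions of class C^k on an open set *)

Section SmoothFunctions.
Context {R : realType} {U : normedModType R} (V : set U).
Hypothesis oV : open V.

Lemma near_open (P : U -> Prop) x : V x -> (forall y, V y -> P y) ->
  \forall y \near x, P y.
Proof. by move=> Vx VP; apply: filterS VP _; exact: open_nbhs_nbhs. Qed.

Lemma continuous_on_eq (W : normedModType R) (f h : U -> W) x :
  (forall y, V y -> f y = h y) -> V x ->
  {for x, continuous f} -> {for x, continuous h}.
Proof.
move=> fh Vx cf; rewrite /prop_for /continuous_at -(fh x Vx).
by apply: cvg_trans cf; apply: near_eq_cvg; exact: near_open.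
Qed.

(** The rules of differentiation identify derivatives only on [V]; openness of [V] makes that enough
    for the closure properties below. *)
Lemma Ck_on_eq (W : normedModType R) k (f h : U -> W) :
  (forall y, V y -> f y = h y) -> Ck_on V k f -> Ck_on V k h.
Proof.
elim: k f h => [|k IH] f h fh [cf df]; split.
- by move=> x Vx; exact: continuous_on_eq fh Vx (cf x Vx).
- by [].
- by move=> x Vx; exact: continuous_on_eq fh Vx (cf x Vx).
move=> v; have [dfv Cv] := df v; split.
  by move=> x Vx; apply: near_eq_derivable (dfv x Vx); exact: near_open.
by apply: IH Cv => y Vy; apply: near_eq_derive; exact: near_open.
Qed.

Lemma Ck_onS (W : normedModType R) k (f : U -> W) : Ck_on V k.+1 f -> Ck_on V k f.
Proof.
elim: k f => [|k IH] f [cf df]; split=> // v; have [dfv Cv] := df v.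
by split=> //; apply: IH.
Qed.

Lemma Ck_onD k (f h : U -> R) :
  Ck_on V k f -> Ck_on V k h -> Ck_on V k (f + h).
Proof.
elim: k f h => [|k IH] f h [cf df] [ch dh]; split.
1,3: by move=> x Vx; apply: continuousD; [exact: cf|exact: ch].
  by [].
move=> v; have [dfv Cfv] := df v; have [dhv Chv] := dh v; split.
  by move=> x Vx; apply: derivableD; [exact: dfv|exact: dhv].
apply: (Ck_on_eq _ (IH _ _ Cfv Chv)) => y Vy.
by rewrite deriveD//; [exact: dfv|exact: dhv].
Qed.

Lemma Ck_onM k (f h : U -> R) :
  Ck_on V k f -> Ck_on V k h -> Ck_on V k (f * h).
Proof.
elim: k f h => [|k IH] f h Cf Ch; have [cf df] := Cf; have [ch dh] := Ch; split.
1,3: by move=> x Vx; apply: continuousM; [exact: cf|exact: ch].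
  by [].
move=> v; have [dfv Cfv] := df v; have [dhv Chv] := dh v; split.
  by move=> x Vx; apply: derivableM; [exact: dfv|exact: dhv].
apply: (Ck_on_eq _ (Ck_onD (IH _ _ (Ck_onS Cf) Chv) (IH _ _ (Ck_onS Ch) Cfv))).
by move=> y Vy; rewrite deriveM//; [exact: dfv|exact: dhv].
Qed.

Lemma Ck_on_cst k (c : R) : Ck_on V k (cst c : U -> R).
Proof.
elim: k c => [|k IH] c; (split; first by move=> x _; exact: cst_continuous) => //.
move=> v; split; first by move=> x _; exact: derivable_cst.
by apply: (Ck_on_eq _ (IH 0)) => y _; rewrite derive_cst.
Qed.

Lemma Ck_on_sum k (I : Type) (r : seq I) (F : I -> U -> R) :
  (forall i, Ck_on V k (F i)) -> Ck_on V k (\sum_(i <- r) F i).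
Proof.
move=> CF; elim/big_rec: _ => [|i f _ Cf]; first exact: (Ck_on_cst k 0).
exact: Ck_onD.
Qed.

Lemma Ck_on_coord m k (f : U -> 'rV[R]_m) j :
  Ck_on V k f -> Ck_on V k (fun y => f y 0 j).
Proof.
elim: k f => [|k IH] f [cf df]; split.
1,3: by move=> x Vx; apply: (@continuous_comp _ _ _ f (fun r : 'rV[R]_m => r 0 j));
  [exact: cf|exact: coord_continuous].
  by [].
move=> v; have [dfv Cfv] := df v; split.
  by move=> x Vx; exact: (derivable_mxP f x v).1 (dfv x Vx) 0 j.
by apply: (Ck_on_eq _ (IH _ Cfv)) => y Vy; rewrite (derive_mx (dfv y Vy)) mxE.
Qed.

Section SmoothOn.
Variables (f : U -> R).
Hypothesis sf : smooth_on V f.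

Lemma smooth_derivable v y : V y -> derivable f y v.
Proof. by have [_ /(_ v)[+ _]] := sf 1; apply. Qed.

Lemma smooth_derive_continuous v y : V y -> {for y, continuous ('D_v f)}.
Proof. by have [_ /(_ v)[_ [+ _]]] := sf 1; apply. Qed.

Lemma smooth_deriveD u v x : V x -> 'D_(u + v) f x = 'D_u f x + 'D_v f x.
Proof.
move=> Vx; apply: (@derive_direction_add _ _ V); first exact: open_nbhs_nbhs.
  by move=> w y; exact: smooth_derivable.
by move=> w; exact: smooth_derive_continuous.
Qed.

Lemma smooth_deriveZ c v x : V x -> 'D_(c *: v) f x = c * 'D_v f x.
Proof. by move=> Vx; have [] := is_derive_scale_direction c (smooth_derivable (v := v) Vx). Qed.

End SmoothOn.

Lemma C2_derive_comm (f : U -> R) u v x : Ck_on V 2 f -> V x ->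
  'D_u ('D_v f) x = 'D_v ('D_u f) x.
Proof.
move=> Cf Vx; apply: (@derive_direction_comm _ _ V) => //.
- by move=> w y; have [_ /(_ w)[+ _]] := Cf; apply.
- by move=> w w' y; have [_ /(_ w)[_ [_ /(_ w')[+ _]]]] := Cf; apply.
- by move=> w w'; have [_ /(_ w)[_ [_ /(_ w')[_ [+ _]]]]] := Cf; apply.
Qed.

End SmoothFunctions.

(** * Traces of tensors on a Hermitian vector space *)

Section LinearMaps.
Context {R : realFieldType} {E V : lmodType R}.
Implicit Types f : E -> V.

Lemma linD f : linear f -> forall u v, f (u + v) = f u + f v.
Proof. by move=> lf u v; rewrite -[u in LHS]scale1r lf scale1r. Qed.

Lemma lin0 f : linear f -> f 0 = 0.
Proof. by move=> lf; have /eqP := linD lf 0 0; rewrite addr0 addrC -subr_eq subrr => /eqP. Qed.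

Lemma linZ f : linear f -> forall c u, f (c *: u) = c *: f u.
Proof. by move=> lf c u; rewrite -[c *: u]addr0 lf (lin0 lf) addr0. Qed.

Lemma linN f : linear f -> forall u, f (- u) = - f u.
Proof. by move=> lf u; rewrite -scaleN1r (linZ lf) scaleN1r. Qed.

Lemma linB f : linear f -> forall u v, f (u - v) = f u - f v.
Proof. by move=> lf u v; rewrite (linD lf) (linN lf). Qed.

Lemma lin_sum f : linear f -> forall (I : finType) (F : I -> E),
  f (\sum_i F i) = \sum_i f (F i).
Proof. by move=> lf I F; apply: (big_morph f (linD lf) (lin0 lf)). Qed.

End LinearMaps.

(** Same body as [bilin], over an arbitrary module, so that the algebra below is free of charts and
    coordinates. *)
Definition blin (R : realFieldType) (E V : lmodType R) (f : E -> E -> V) : Prop :=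
  (forall u, linear (f u)) /\ (forall v, linear (f ^~ v)).

Section Traces.
Context {R : realFieldType} {E : lmodType R} {I : finType}.
Variables (g : E -> E -> R) (e : I -> E).
Hypothesis glin : blin (g : E -> E -> R^o).
Hypothesis gC : forall u v, g u v = g v u.
Hypothesis expand : forall v, v = \sum_i g v (e i) *: e i.

Lemma gDl u v w : g (u + v) w = g u w + g v w.
Proof. exact: (linD (glin.2 w)). Qed.
Lemma gDr u v w : g w (u + v) = g w u + g w v.
Proof. exact: (linD (glin.1 w)). Qed.
Lemma gZl c u w : g (c *: u) w = c * g u w.
Proof. exact: (linZ (glin.2 w)). Qed.
Lemma gZr c u w : g w (c *: u) = c * g w u.
Proof. exact: (linZ (glin.1 w)). Qed.
Lemma gNl u w : g (- u) w = - g u w.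
Proof. exact: (linN (glin.2 w)). Qed.
Lemma gNr u w : g w (- u) = - g w u.
Proof. exact: (linN (glin.1 w)). Qed.

Lemma sum_contract (f : E -> R) v : linear (f : E -> R^o) ->
  \sum_i g v (e i) * f (e i) = f v.
Proof.
move=> lf; rewrite [in RHS](expand v) (lin_sum lf).
by apply: eq_bigr => i _; rewrite (linZ lf).
Qed.

(** Expanding [A (e i)] in the basis gives a double sum with coefficients [g (A (e i)) (e j)], which
    are skew in [i] and [j]. *)
Lemma tr_skew (A : E -> E) (f : E -> E -> R) : linear A ->
  (forall u v, g (A u) v = - g u (A v)) -> blin (f : E -> E -> R^o) ->
  \sum_i f (A (e i)) (e i) = - \sum_i f (e i) (A (e i)).
Proof.
move=> lA sA [lf1 lf2].
transitivity (\sum_i \sum_j g (A (e i)) (e j) * f (e j) (e i)).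
  by apply: eq_bigr => i _; rewrite (sum_contract _ (lf2 _)).
rewrite exchange_big -sumrN; apply: eq_bigr => j _ /=.
rewrite -(sum_contract _ (lf1 _)) -sumrN; apply: eq_bigr => i _.
by rewrite sA gC mulNr.
Qed.

Lemma tr_comm (A B : E -> E) : linear A -> linear B ->
  \sum_i g (A (B (e i))) (e i) = \sum_i g (B (A (e i))) (e i).
Proof.
move=> lA lB.
have comp (C D : E -> E) : linear C -> \sum_i g (C (D (e i))) (e i) =
    \sum_i \sum_j g (D (e i)) (e j) * g (C (e j)) (e i).
  move=> lC; apply: eq_bigr => i _.
  rewrite (@sum_contract (fun v => g (C v) (e i)))// => c u v.
  by rewrite lC gDl gZl.
rewrite (comp _ _ lA) (comp _ _ lB) exchange_big.
by apply: eq_bigr => i _; apply: eq_bigr => j _; rewrite mulrC.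
Qed.

End Traces.

Lemma blin_add (R : realFieldType) (E V : lmodType R) (f h : E -> E -> V) :
  blin f -> blin h -> blin (fun u v => f u v + h u v).
Proof.
move=> [f1 f2] [h1 h2]; split=> w c u v /=.
  by rewrite f1 h1 scalerDr addrACA.
by rewrite (f2 w) (h2 w) scalerDr addrACA.
Qed.

Section BilinearMaps.
Context {R : realFieldType} {E V : lmodType R} (f : E -> E -> V).
Hypothesis bf : blin f.

Lemma blinPl c u v w : f (c *: u + v) w = c *: f u w + f v w.
Proof. exact: (bf.2 w). Qed.
Lemma blinPr c u v w : f w (c *: u + v) = c *: f w u + f w v.
Proof. exact: (bf.1 w). Qed.
Lemma blinDl u v w : f (u + v) w = f u w + f v w.
Proof. exact: (linD (bf.2 w)). Qed.
Lemma blinDr u v w : f w (u + v) = f w u + f w v.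
Proof. exact: (linD (bf.1 w)). Qed.
Lemma blinZl c u w : f (c *: u) w = c *: f u w.
Proof. exact: (linZ (bf.2 w)). Qed.
Lemma blinZr c u w : f w (c *: u) = c *: f w u.
Proof. exact: (linZ (bf.1 w)). Qed.
Lemma blinNl u w : f (- u) w = - f u w.
Proof. exact: (linN (bf.2 w)). Qed.
Lemma blinNr u w : f w (- u) = - f w u.
Proof. exact: (linN (bf.1 w)). Qed.

End BilinearMaps.

Ltac push_linear := repeat match goal with
  | H : linear ?A |- context [?A (_ + _)] => rewrite (linD H)
  | H : linear ?A |- context [?A (- _)] => rewrite (linN H)
  | H : linear ?A |- context [?A (_ *: _)] => rewrite (linZ H)
  | H : blin ?T |- context [?T (_ + _) _] => rewrite (blinDl H)
  | H : blin ?T |- context [?T _ (_ + _)] => rewrite (blinDr H)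
  | H : blin ?T |- context [?T (- _) _] => rewrite (blinNl H)
  | H : blin ?T |- context [?T _ (- _)] => rewrite (blinNr H)
  | H : blin ?T |- context [?T (_ *: _) _] => rewrite (blinZl H)
  | H : blin ?T |- context [?T _ (_ *: _)] => rewrite (blinZr H)
  end.

Ltac prove_linear := move=> ? ? ? /=; push_linear; rewrite /GRing.scale /=; ring.
Ltac prove_blin := split=> ?; prove_linear.

(** * Contractions of the Gray-Hervella components *)

Section HermitianTraces.
Context {R : realFieldType} {E : lmodType R} {I : finType}.
Variables (g : E -> E -> R) (J : E -> E) (e : I -> E).
Hypothesis glin : blin (g : E -> E -> R^o).
Hypothesis gC : forall u v, g u v = g v u.
Hypothesis expand : forall v, v = \sum_i g v (e i) *: e i.
Hypothesis Jlin : linear J.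
Hypothesis JJ : forall v, J (J v) = - v.
Hypothesis gJ : forall u v, g (J u) (J v) = g u v.
Implicit Types T S : E -> E -> E.

Lemma gJl u v : g (J u) v = - g u (J v).
Proof. by rewrite -[in RHS]gJ JJ (gNr glin) opprK. Qed.

Lemma J_adj u v : g u (J v) = - g (J u) v.
Proof. by rewrite gJl opprK. Qed.

(** Carrying one [J] across the trace by [tr_skew] costs a sign, which [J (J v) = - v]
    compensates. *)
Lemma trJJ (f : E -> E -> R) : blin (f : E -> E -> R^o) ->
  \sum_i f (J (e i)) (J (e i)) = \sum_i f (e i) (e i).
Proof.
move=> fl; have fl' : blin (fun u v => f u (J v) : R^o) by prove_blin.
rewrite (tr_skew gC expand Jlin gJl fl') -sumrN.
by apply: eq_bigr => i _; rewrite JJ (blinNr fl) opprK.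
Qed.

Definition skew_valued T := forall u v w, g (T u v) w = - g v (T u w).
Definition anti_J T := forall u v, T u (J v) = - J (T u v).

(* The contributions to [d omega] of the components of [xi] in W1, W3 and W4; in
   the last one [f] stands for [theta]. *)
Definition domega_W1 T X Y Z := 6 * g (T X Y) (J Z).
Definition domega_W3 T X Y Z :=
  2 * (g (T X Y) (J Z) + g (T Y Z) (J X) + g (T Z X) (J Y)).
Definition domega_W4 (f : E -> R) X Y Z :=
  f X * g Y (J Z) + f Y * g Z (J X) + f Z * g X (J Y).

Lemma eq_opp0 (s : R) : s = - s -> s = 0.
Proof. by move=> ?; lra. Qed.

Section Pairings.
Variables S T : E -> E -> E.
Hypotheses (Slin : blin S) (Tlin : blin T).
Hypotheses (Ssk : skew_valued S) (Tsk : skew_valued T).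
Hypotheses (SJ : anti_J S) (TJ : anti_J T).

(** Commuting with [J] in the first argument characterizes W3 + W4, anticommuting W1 + W2. Replacing
    [e i] by [J (e i)] keeps the trace and here changes its sign; the next two lemmas hold for the
    same reason. *)
Lemma pairing_type34 X Y : (forall u v, T (J u) v = J (T u v)) ->
  \sum_i g (S Y (e i)) (T (e i) X) = 0.
Proof.
move=> T34; apply: eq_opp0.
have fl : blin (fun u v => g (S Y u) (T v X) : R^o) by prove_blin.
by rewrite -{1}(trJJ fl) -sumrN; apply: eq_bigr => i _; rewrite SJ T34 (gNl glin) gJ.
Qed.

Lemma pairing_type12_type34 X Y : (forall u v, T (J u) v = - J (T u v)) ->
  (forall u v, S (J u) v = J (S u v)) ->
  \sum_i g (T (e i) X) (S (e i) Y) = 0.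
Proof.
move=> T12 S34; apply: eq_opp0.
have fl : blin (fun u v => g (T u X) (S v Y) : R^o) by prove_blin.
by rewrite -{1}(trJJ fl) -sumrN; apply: eq_bigr => i _; rewrite S34 T12 (gNl glin) gJ.
Qed.

Lemma trace_comp_type12_type34 X Y : (forall u v, T (J u) v = - J (T u v)) ->
  (forall u v, S (J u) v = J (S u v)) ->
  \sum_i g (S (T (e i) X) Y) (e i) = 0.
Proof.
move=> T12 S34; apply: eq_opp0.
have fl : blin (fun u v => g (S (T u X) Y) v : R^o) by prove_blin.
rewrite -{1}(trJJ fl) -sumrN; apply: eq_bigr => i _.
by rewrite T12 (blinNl Slin) S34 (gNl glin) gJ.
Qed.

(** Apply [tr_skew] to the skew map [S Y] and rewrite [T (S Y (e i)) X] by the cyclic identity. The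
    factor [2] is the source of the halves in front of the terms with [xi2]. *)
Lemma pairing_cyclic X Y :
  (forall u v w, g (T u v) w + g (T v w) u + g (T w u) v = 0) ->
  \sum_i g (S Y (e i)) (T X (e i)) = 2 * \sum_i g (S Y (e i)) (T (e i) X).
Proof.
move=> cyc.
have fl : blin (fun u v => g (T u X) v : R^o) by prove_blin.
have SYl : linear (S Y) by exact: Slin.1.
have := tr_skew gC expand SYl (Ssk Y) fl.
rewrite (_ : \sum_i g (T (S Y (e i)) X) (e i) =
  \sum_i g (S Y (e i)) (T (e i) X) - \sum_i g (S Y (e i)) (T X (e i))); last first.
  rewrite -sumrB; apply: eq_bigr => i _.
  have := cyc (S Y (e i)) X (e i); rewrite (gC (T X _)).
  have := Tsk (e i) (S Y (e i)) X; lra.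
have -> : \sum_i g (T (e i) X) (S Y (e i)) = \sum_i g (S Y (e i)) (T (e i) X).
  by apply: eq_bigr => i _; exact: gC.
lra.
Qed.

Lemma trace_comp_left X Y :
  \sum_i g (S (T X (e i)) Y) (e i) = - \sum_i g (T X (e i)) (S (e i) Y).
Proof.
have fl : blin (fun u v => g (S u Y) v : R^o) by prove_blin.
rewrite (tr_skew gC expand (Tlin.1 X) (Tsk X) fl); congr (- _).
by apply: eq_bigr => i _; exact: gC.
Qed.

Lemma trace_contraction_W1 X Y : (forall u v, S u v = - S v u) ->
  \sum_i domega_W1 S (T X (e i) - T (e i) X) Y (J (e i)) =
  6 * (\sum_i g (S Y (e i)) (T (e i) X) - \sum_i g (S Y (e i)) (T X (e i))).
Proof.
move=> S1.
have -> : \sum_i g (S Y (e i)) (T X (e i)) = \sum_i g (S (T X (e i)) Y) (e i).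
  rewrite trace_comp_left -sumrN; apply: eq_bigr => i _.
  by rewrite gC (S1 Y) (gNr glin).
rewrite -sumrB mulr_sumr; apply: eq_bigr => i _; rewrite /domega_W1 JJ (gNr glin).
rewrite (blinDl Slin) (blinNl Slin) (gDl glin) (gNl glin).
rewrite (S1 (T (e i) X)) (gNl glin) (Ssk Y (T _ _)) (gC (T (e i) X)); ring.
Qed.

Lemma trace_contraction_W3 X Y : (forall u v, S (J u) v = J (S u v)) ->
  \sum_i domega_W3 S (T X (e i) - T (e i) X) Y (J (e i)) =
  2 * (\sum_i g (S (T (e i) X) Y) (e i) - \sum_i g (S Y (e i)) (T X (e i)) +
    \sum_i g (S Y (e i)) (T (e i) X) + \sum_i g (T (e i) X) (S (e i) Y)).
Proof.
move=> S34.
have aS Z w : domega_W3 S Z Y (J w) = 2 * (- g (S Z Y) w - g (S Y w) Z - g Z (S w Y)).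
  by rewrite /domega_W3 JJ SJ S34 !(gNr glin) (gNl glin) !gJ (Ssk w).
have tl := trace_comp_left X Y.
(* The second bracket collects the two remaining terms, whose sums cancel by [trace_comp_left]. *)
transitivity (\sum_i (2 * (g (S (T (e i) X) Y) (e i) - g (S Y (e i)) (T X (e i)) +
    g (S Y (e i)) (T (e i) X) + g (T (e i) X) (S (e i) Y))
  - 2 * (g (S (T X (e i)) Y) (e i) + g (T X (e i)) (S (e i) Y)))).
  apply: eq_bigr => i _; rewrite aS.
  rewrite (blinDl Slin) (blinNl Slin) !(gDl glin) !(gNl glin).
  rewrite !(gDr glin) !(gNr glin); ring.
rewrite sumrB -!mulr_sumr [X in _ - 2 * X]big_split /= tl addNr mulr0 subr0.
by rewrite !big_split /= sumrN.
Qed.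

End Pairings.

Lemma g_inj u v : (forall w, g u w = g v w) -> u = v.
Proof.
by move=> uv; rewrite [LHS]expand [RHS]expand; apply: eq_bigr => i _; rewrite uv.
Qed.

Lemma W1_alternating T : blin T -> (forall u, T u u = 0) -> forall u v, T u v = - T v u.
Proof.
move=> Tl T0 u v; apply/eqP; rewrite -addr_eq0; apply/eqP.
by have := T0 (u + v); rewrite (blinDl Tl) !(blinDr Tl) !T0 add0r addr0.
Qed.

Lemma W1_type12 T : blin T -> anti_J T -> (forall u, T u u = 0) ->
  forall u v, T (J u) v = - J (T u v).
Proof.
move=> Tl TJ T0 u v.
by rewrite (W1_alternating Tl T0) TJ opprK (W1_alternating Tl T0 v) (linN Jlin).
Qed.

Section W2.
Variable T : E -> E -> E.
Hypotheses (Tlin : blin T) (Tsk : skew_valued T) (TJ : anti_J T).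
Hypothesis cyc : forall u v w,
  g (T u v) (J w) + g (T v w) (J u) + g (T w u) (J v) = 0.

Let b u v w := g (T u v) (J w).

Let bJJ u v w : b u v (J (J w)) = - b u v w.
Proof. by rewrite /b JJ (gNr glin). Qed.

Let bJ u v w : b u (J v) w = b u v (J w).
Proof. by rewrite /b TJ JJ (gNl glin) gJ (gNr glin). Qed.

(* The cyclic identity at [(u, v, w)] with [J] put on one argument, then on all
   three, determines [b (J u) v w]. *)
Lemma W2_type12 u v : T (J u) v = - J (T u v).
Proof.
suff Jw w : g (T (J u) v) (J w) = g (- J (T u v)) (J w).
  by apply: g_inj => w; have := Jw (- J w); rewrite (linN Jlin) JJ opprK.
have -> : g (- J (T u v)) (J w) = b u v (J w).
  by rewrite /b JJ (gNl glin) gJ (gNr glin).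
have c x y z : b x y z + b y z x + b z x y = 0 := cyc x y z.
have := c (J u) v w; have := c u (J v) w; have := c u v (J w).
have := c (J u) (J v) (J w); rewrite !bJ !bJJ -/(b _ _ _); lra.
Qed.

(** [J] moves freely between the three arguments of [b], so the identity with [J] taken at
    [(u, v, J w)] becomes one without it. *)
Lemma W2_cyclic u v w : g (T u v) w + g (T v w) u + g (T w u) v = 0.
Proof.
have bE x y z : g (T x y) z = - b x y (J z) by rewrite /b JJ (gNr glin) opprK.
have W12 x y z : b (J x) y z = b x y (J z).
  by rewrite /b W2_type12 (gNl glin) gJ JJ (gNr glin).
have : b u v (J w) + b v (J w) u + b (J w) u v = 0 by exact: cyc.
by rewrite !bE bJ W12; lra.
Qed.

End W2.

Lemma W3_type34 T : anti_J T -> (forall u v, T (J u) (J v) = T u v) ->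
  forall u v, T (J u) v = J (T u v).
Proof. by move=> TJ T3 u v; rewrite -(T3 u v) TJ (linN Jlin) JJ opprK. Qed.

Lemma sum_contractl (f : E -> R) v : linear (f : E -> R^o) ->
  \sum_i g (e i) v * f (e i) = f v.
Proof.
move=> fl; rewrite -[RHS](sum_contract expand)//.
by apply: eq_bigr => i _; rewrite gC.
Qed.

Lemma sum_contract_J (f : E -> R) v : linear (f : E -> R^o) ->
  \sum_i g v (J (e i)) * f (e i) = - f (J v).
Proof.
move=> fl; rewrite -(sum_contract expand (J v) fl) -sumrN.
by apply: eq_bigr => i _; rewrite gJl mulNr opprK.
Qed.

Lemma g_suml (F : I -> E) v : g (\sum_i F i) v = \sum_i g (F i) v.
Proof. exact: (lin_sum (glin.2 v)). Qed.

Lemma skew_diag T u v : skew_valued T -> g (T u v) v = 0.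
Proof. by move=> Tsk; apply: eq_opp0; rewrite [LHS]Tsk gC. Qed.

Lemma domega_W1_trace T Z : skew_valued T -> \sum_i domega_W1 T Z (e i) (J (e i)) = 0.
Proof.
move=> Tsk; apply: big1 => i _.
by rewrite /domega_W1 JJ (gNr glin) (skew_diag _ _ Tsk) oppr0 mulr0.
Qed.

Lemma domega_W3_trace T Z : skew_valued T -> anti_J T ->
  (forall u v, T (J u) v = J (T u v)) -> \sum_i T (e i) (e i) = 0 ->
  \sum_i domega_W3 T Z (e i) (J (e i)) = 0.
Proof.
move=> Tsk TJ T34 T0.
transitivity (\sum_i (-4) * g (T (e i) (e i)) Z); last first.
  by rewrite -mulr_sumr -g_suml T0 -(scale0r 0) (gZl glin) mul0r mulr0.
apply: eq_bigr => i _; rewrite /domega_W3 JJ (gNr glin) (skew_diag _ _ Tsk).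
by rewrite TJ T34 (gNl glin) !gJ (Tsk _ Z) (gC Z); ring.
Qed.

(** Contraction of [f /\ omega] with [omega]: the trace of [g] gives [- 2 n], and each of the other
    two terms gives [1]. *)
Lemma domega_W4_trace (n : R) (f : E -> R) Z : linear (f : E -> R^o) ->
  \sum_i g (e i) (e i) = 2 * n ->
  \sum_i domega_W4 f Z (e i) (J (e i)) = (2 - 2 * n) * f Z.
Proof.
move=> fl trg.
have fg : blin (fun u v => f u * g Z v : R^o).
  by split=> ? c u v /=; push_linear; rewrite /GRing.scale /=; ring.
transitivity (\sum_i (- f Z * g (e i) (e i) + g (e i) Z * f (e i) +
    f (J (e i)) * g Z (J (e i)))).
  by apply: eq_bigr => i _; rewrite /domega_W4 JJ (gNr glin) gJ; ring.
rewrite !big_split /= -mulr_sumr trg (sum_contractl _ fl) (trJJ fg).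
rewrite (eq_bigr (fun i => g (e i) Z * f (e i))) => [|i _].
  by rewrite (sum_contractl _ fl); ring.
by rewrite gC mulrC.
Qed.

Lemma domega_W1_divergence (D : E -> E -> E -> E) X Y : (forall u, skew_valued (D u)) ->
  (forall u v w, D u v w = - D u w v) ->
  \sum_i domega_W1 (D (e i)) X Y (J (e i)) = - 6 * \sum_i g (D (e i) (e i) X) Y.
Proof.
move=> Dsk D1; rewrite mulr_sumr; apply: eq_bigr => i _; rewrite /domega_W1 JJ (gNr glin).
by rewrite Dsk (D1 _ X) (gNr glin) (gC Y); ring.
Qed.

Lemma domega_W3_divergence (D : E -> E -> E -> E) X Y : (forall u, skew_valued (D u)) ->
  (forall u, anti_J (D u)) -> (forall w u v, D w (J u) v = J (D w u v)) ->
  \sum_i domega_W3 (D (e i)) X Y (J (e i)) =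
  2 * (\sum_i g (D (e i) Y X) (e i) - \sum_i g (D (e i) X Y) (e i) +
    \sum_i g (D (e i) (e i) X) Y).
Proof.
move=> Dsk DJ D34; rewrite -sumrB -big_split mulr_sumr; apply: eq_bigr => i _.
rewrite /domega_W3 JJ DJ D34 (gNr glin) (gNl glin) !gJ (Dsk _ Y (e i)) (gC (e i)) /=; ring.
Qed.

Lemma domega_W4_divergence (D : E -> E -> R) X Y : blin (D : E -> E -> R^o) ->
  \sum_i domega_W4 (D (e i)) X Y (J (e i)) =
  D X Y - D Y X + (\sum_i D (e i) (J (e i))) * g X (J Y).
Proof.
move=> Dl.
rewrite -(sum_contractl X (Dl.2 Y)) -(sum_contractl Y (Dl.2 X)) mulr_suml.
rewrite -sumrB -big_split; apply: eq_bigr => i _ /=.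
by rewrite /domega_W4 JJ (gNr glin) gJ (gC Y); ring.
Qed.

Lemma trace_contraction_W4 T (t : E) X Y : blin T -> skew_valued T -> anti_J T ->
  \sum_i domega_W4 (g t) (T X (e i) - T (e i) X) Y (J (e i)) =
  - g t (T X Y - T Y X) + g t Y * g (\sum_i T (e i) (e i)) X - g t (T X Y) +
    g (T (J t) X) (J Y).
Proof.
move=> Tl Tsk TJ.
have fl : linear (fun v => g t (T X v - T v X) : R^o) by prove_linear.
have hl : linear (fun v => g (T X v - T v X) (J Y) : R^o) by prove_linear.
rewrite -(sum_contractl Y fl) g_suml mulr_sumr -sumrN.
(* This cancels [- g t (T X Y)] and leaves the torsion in the direction [J t], a contraction over
   the basis. *)
have -> : g (T (J t) X) (J Y) =
    g t (T X Y) - g (T X (J t) - T (J t) X) (J Y).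
  rewrite (gDl glin) (gNl glin) TJ (gNl glin) gJ (Tsk X t); ring.
rewrite addrA subrK -(sum_contract_J t hl) -!big_split; apply: eq_bigr => i _ /=.
have eZ : g (e i) (T X (e i) - T (e i) X) = g (T (e i) (e i)) X.
  by rewrite (gDr glin) (gNr glin) gC (skew_diag _ _ Tsk) add0r Tsk.
by rewrite /domega_W4 JJ (gNr glin) gJ eZ (gC Y); ring.
Qed.

(** * Contractions involving the component in W4 *)

Section W4.
Variables (t : E) (T : E -> E -> E).
Hypothesis W4E : forall u v, 4 *: T u v =
  g u v *: t - g t v *: u - g (J u) v *: J t - g t (J v) *: J u.

Let neq40 : (4 : R) != 0. Proof. by rewrite pnatr_eq0. Qed.

Lemma g_W4 u v w : 4 * g (T u v) w = g u v * g t w - g t v * g u w -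
  g (J u) v * g (J t) w - g t (J v) * g (J u) w.
Proof. by rewrite -(gZl glin) W4E !(gDl glin) !(gNl glin) !(gZl glin). Qed.

Lemma W4_type34 u v : T (J u) v = J (T u v).
Proof.
apply: g_inj => w; apply: (mulfI neq40).
by rewrite (gJl (T u v)) mulrN !g_W4 JJ !(gNl glin) !gJ !J_adj; ring.
Qed.

(** Of the four terms of [W4E] the first contributes [2 n], the second and the fourth [- 1] each,
    and the third vanishes since [J] is skew; division by [4] leaves [(n - 1) / 2]. *)
Lemma W4_trace (n : R) : \sum_i g (e i) (e i) = 2 * n ->
  2 *: \sum_i T (e i) (e i) = (n - 1) *: t.
Proof.
move=> trg; apply: g_inj => w; rewrite (gZl glin) (gZl glin) g_suml.
have gt : blin (fun u v => g t u * g v w : R^o) by prove_blin.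
apply: (mulfI neq40).
transitivity (2 * \sum_i (g (e i) (e i) * g t w - g t (e i) * g (e i) w -
    g (J (e i)) (e i) * g (J t) w - g t (J (e i)) * g (J (e i)) w)).
  rewrite mulrCA; congr (2 * _); rewrite mulr_sumr; apply: eq_bigr => i _.
  exact: g_W4.
rewrite !sumrB -!mulr_suml trg (trJJ gt) (sum_contract expand t (glin.2 w)).
rewrite [\sum_i g (J _) _]big1 => [|i _]; first ring.
by apply: eq_opp0; rewrite {1}gJl gC.
Qed.

Lemma pairing_W4 S X Y : blin S -> skew_valued S -> anti_J S ->
  \sum_i g (S Y (e i)) (T X (e i)) = g (S Y X) t.
Proof.
move=> Sl Ssk SJ; apply: (mulfI neq40); rewrite mulr_sumr.
have l w : linear (fun v => g (S Y v) w : R^o) by prove_linear.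
transitivity (\sum_i (g X (e i) * g (S Y (e i)) t - g t (e i) * g (S Y (e i)) X -
    g (J X) (e i) * g (S Y (e i)) (J t) - g t (J (e i)) * g (S Y (e i)) (J X))).
  by apply: eq_bigr => i _; rewrite gC g_W4 !(gC _ (S _ _)).
rewrite !sumrB !(sum_contract expand _ (l _)) (sum_contract_J _ (l _)).
by rewrite !SJ !(gNl glin) !gJ (Ssk _ t) (gC t); ring.
Qed.

Lemma trace_comp_W4 S X Y : blin S -> skew_valued S -> anti_J S ->
  (forall u v, S (J u) v = J (S u v)) -> \sum_i S (e i) (e i) = 0 ->
  2 * \sum_i g (S (T (e i) X) Y) (e i) = g (S t Y) X.
Proof.
move=> Sl Ssk SJ S34 S0; apply: (mulfI (_ : (2 : R) != 0)); first by rewrite pnatr_eq0.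
transitivity (\sum_i (g (e i) X * g (S t Y) (e i) + g t X * g (S (e i) (e i)) Y +
    g (e i) (J X) * g (S (J t) Y) (e i) + - g t (J X) * g (S (e i) (e i)) (J Y))).
  rewrite !mulr_sumr; apply: eq_bigr => i _; rewrite mulrA.
  rewrite (_ : 2 * 2 = 4); last by ring.
  rewrite -(gZl glin) -(blinZl Sl) W4E.
  rewrite !(blinDl Sl) !(blinNl Sl) !(blinZl Sl) !(gDl glin) !(gNl glin) !(gZl glin).
  rewrite (S34 (e i)) !gJl (Ssk _ (e i) Y) (Ssk _ (e i) (J Y)) SJ (gNr glin).
  rewrite (gC (e i) (J (S _ _))) gJl (gC (e i) (S _ _)); ring.
rewrite !big_split /= -!mulr_sumr -!g_suml S0 !(lin0 (glin.2 _)).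
rewrite !(sum_contractl _ (glin.1 _)) S34 gJ; ring.
Qed.

Lemma pairing_left_W4 S X Y : blin S -> skew_valued S -> anti_J S ->
  (forall u v, S (J u) v = J (S u v)) -> \sum_i S (e i) (e i) = 0 ->
  2 * \sum_i g (T (e i) X) (S (e i) Y) = g t (S X Y).
Proof.
move=> Sl Ssk SJ S34 S0; apply: (mulfI (_ : (2 : R) != 0)); first by rewrite pnatr_eq0.
have l w : linear (fun v => g w (S v Y) : R^o) by prove_linear.
transitivity (\sum_i (g (e i) X * g t (S (e i) Y) + g t X * g (S (e i) (e i)) Y +
    g (e i) (J X) * g (J t) (S (e i) Y) + g t (J X) * g (S (e i) (e i)) (J Y))).
  rewrite !mulr_sumr; apply: eq_bigr => i _; rewrite mulrA.
  rewrite (_ : 2 * 2 = 4); last by ring.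
  by rewrite g_W4 gJl (Ssk _ (e i) Y) (Ssk _ (e i) (J Y)) SJ (gNr glin) (gJl (e i) (S _ _)); ring.
rewrite !big_split /= -!mulr_sumr -!g_suml S0 !(lin0 (glin.2 _)).
rewrite !(sum_contractl _ (l _)) S34 gJ; ring.
Qed.

End W4.

(** * The pointwise identity *)

Section DifferentialOfLeeForm.
Variables (n : R) (t : E) (x1 x2 x3 x4 : E -> E -> E).
(** These stand for the derivatives of [xi1], [xi3] and [theta] by the minimal connection at one
    point, the first argument being the direction. [D1 u] and [D3 u] satisfy below the same
    algebraic conditions as [x1] and [x3]. *)
Variables (D1 D3 : E -> E -> E -> E) (Dt : E -> E -> R).
Hypothesis trg : \sum_i g (e i) (e i) = 2 * n.
Hypotheses (l1 : blin x1) (l2 : blin x2) (l3 : blin x3) (l4 : blin x4).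
Hypotheses (sk1 : skew_valued x1) (sk2 : skew_valued x2)
  (sk3 : skew_valued x3) (sk4 : skew_valued x4).
Hypotheses (J1 : anti_J x1) (J2 : anti_J x2) (J3 : anti_J x3) (J4 : anti_J x4).
Hypothesis x1_diag : forall u, x1 u u = 0.
Hypothesis x2_cyc : forall u v w,
  g (x2 u v) (J w) + g (x2 v w) (J u) + g (x2 w u) (J v) = 0.
Hypothesis x3_JJ : forall u v, x3 (J u) (J v) = x3 u v.
Hypothesis x3_trace : \sum_i x3 (e i) (e i) = 0.
Hypothesis x4E : forall u v, 4 *: x4 u v =
  g u v *: t - g t v *: u - g (J u) v *: J t - g t (J v) *: J u.
Hypotheses (lD1 : forall u, blin (D1 u)) (lD3 : forall u, blin (D3 u)).
Hypotheses (lD1' : forall v w, linear (D1 ^~ v ^~ w)).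
Hypotheses (lD3' : forall v w, linear (D3 ^~ v ^~ w)).
Hypotheses (skD1 : forall u, skew_valued (D1 u)).
Hypotheses (skD3 : forall u, skew_valued (D3 u)).
Hypotheses (JD1 : forall u, anti_J (D1 u)) (JD3 : forall u, anti_J (D3 u)).
Hypothesis D1_diag : forall u v, D1 u v v = 0.
Hypothesis D3_JJ : forall w u v, D3 w (J u) (J v) = D3 w u v.
Hypothesis D3_trace : forall u, \sum_i D3 u (e i) (e i) = 0.
Hypothesis lDt : blin (Dt : E -> E -> R^o).

Definition torsion_sum u v := x1 u v + x2 u v + x3 u v + x4 u v.
Local Notation T := torsion_sum.
Definition torsion u v := T u v - T v u.
Definition domega X Y Z := domega_W1 x1 X Y Z + domega_W3 x3 X Y Z + domega_W4 (g t) X Y Z.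
(** The covariant derivative of [domega]: as [g] and [J] are parallel, only [x1], [x3] and [theta]
    get differentiated. *)
Definition Ddomega u X Y Z :=
  domega_W1 (D1 u) X Y Z + domega_W3 (D3 u) X Y Z + domega_W4 (Dt u) X Y Z.

(** The equation [d (d omega) = 0] written with a connection that has torsion: the alternated
    covariant derivative, and one torsion term for each pair of arguments. *)
Hypothesis closed : forall X Y Z W,
  Ddomega X Y Z W - Ddomega Y X Z W + Ddomega Z X Y W - Ddomega W X Y Z
  + domega (torsion X Y) Z W - domega (torsion X Z) Y W
  + domega (torsion X W) Y Z + domega (torsion Y Z) X W
  - domega (torsion Y W) X Z + domega (torsion Z W) X Y = 0.

Let alt1 := W1_alternating l1 x1_diag.
Let type1 := W1_type12 l1 J1 x1_diag.
Let type2 := W2_type12 J2 x2_cyc.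
Let cyc2 := W2_cyclic J2 x2_cyc.
Let type3 := W3_type34 J3 x3_JJ.
Let type4 := W4_type34 x4E.
Let neq20 : (2 : R) != 0. Proof. by rewrite pnatr_eq0. Qed.

Lemma torsion_sum_lin : blin T. Proof. by do 3!apply: blin_add => //. Qed.
Let lT := torsion_sum_lin.

Lemma torsion_sum_skew : skew_valued T.
Proof.
move=> u v w; rewrite /torsion_sum !(gDl glin) !(gDr glin).
by rewrite sk1 sk2 sk3 sk4 !opprD.
Qed.

Lemma torsion_sum_anti_J : anti_J T.
Proof. by move=> u v; rewrite /torsion_sum J1 J2 J3 J4 !(linD Jlin) !opprD. Qed.

(** Only W4 contributes: [x1] vanishes on the diagonal, [x3] is trace-free, and the trace of [x2]
    changes sign when [e i] is replaced by [J (e i)]. *)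
Lemma torsion_sum_trace : 2 *: \sum_i T (e i) (e i) = (n - 1) *: t.
Proof.
rewrite !big_split /= x3_trace addr0 (eq_bigr (fun=> 0)) => [|i _]; last exact: x1_diag.
suff -> : \sum_i x2 (e i) (e i) = 0 by rewrite big1// !add0r; exact: W4_trace.
apply: g_inj => w; rewrite g_suml (lin0 (glin.2 w)); apply: eq_opp0.
have fl : blin (fun u v => g (x2 u v) w : R^o) by prove_blin.
rewrite -{1}(trJJ fl) -sumrN; apply: eq_bigr => i _.
by rewrite J2 type2 (linN Jlin) JJ !opprK (gNl glin).
Qed.

Local Notation pr S S' Y X := (\sum_i g (S Y (e i)) (S' X (e i))).

(** The contraction is [6 (A - B)] with [B] the pairing [pr]. For [x1], [A = - B]; for [x2],
    [A = B / 2] by [pairing_cyclic]; for [x3] and [x4], [A = 0] by type. *)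
Lemma domega_W1_torsion X Y :
  \sum_i domega_W1 x1 (torsion X (e i)) Y (J (e i)) =
  - 12 * pr x1 x1 Y X - 3 * pr x1 x2 Y X - 6 * pr x1 x3 Y X - 6 * g (x1 Y X) t.
Proof.
rewrite (trace_contraction_W1 l1 lT sk1 torsion_sum_skew X Y alt1).
have -> : pr x1 T Y X = pr x1 x1 Y X + pr x1 x2 Y X + pr x1 x3 Y X + pr x1 x4 Y X.
  by rewrite -!big_split; apply: eq_bigr => i _; rewrite !(gDr glin).
have -> : \sum_i g (x1 Y (e i)) (T (e i) X) =
    \sum_i g (x1 Y (e i)) (x1 (e i) X) + \sum_i g (x1 Y (e i)) (x2 (e i) X) +
    \sum_i g (x1 Y (e i)) (x3 (e i) X) + \sum_i g (x1 Y (e i)) (x4 (e i) X).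
  by rewrite -!big_split; apply: eq_bigr => i _; rewrite !(gDr glin).
rewrite (pairing_type34 l1 l3 J1 X Y type3) (pairing_type34 l1 l4 J1 X Y type4).
rewrite (pairing_W4 x4E X Y l1 sk1 J1).
have := pairing_cyclic l1 l2 sk1 sk2 X Y cyc2.
have -> : \sum_i g (x1 Y (e i)) (x1 (e i) X) = - pr x1 x1 Y X.
  by rewrite -sumrN; apply: eq_bigr => i _; rewrite (alt1 (e i)) (gNr glin).
lra.
Qed.

(** Terms quadratic in [x3] stay unevaluated: they are symmetric in [X] and [Y], and only the part
    skew in [X] and [Y] is used later. *)
Lemma domega_W3_torsion X Y :
  \sum_i domega_W3 x3 (torsion X (e i)) Y (J (e i)) =
  - 4 * pr x3 x1 Y X - pr x3 x2 Y X +
  2 * (\sum_i g (x3 (x3 (e i) X) Y) (e i) - pr x3 x3 Y X +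
       \sum_i g (x3 (e i) X) (x3 (e i) Y)) +
  g (x3 t Y) X - 2 * g (x3 Y X) t + g t (x3 X Y).
Proof.
rewrite (trace_contraction_W3 l3 lT sk3 torsion_sum_skew J3 X Y type3).
have -> : pr x3 T Y X = pr x3 x1 Y X + pr x3 x2 Y X + pr x3 x3 Y X + pr x3 x4 Y X.
  by rewrite -!big_split; apply: eq_bigr => i _; rewrite !(gDr glin).
have -> : \sum_i g (x3 Y (e i)) (T (e i) X) =
    \sum_i g (x3 Y (e i)) (x1 (e i) X) + \sum_i g (x3 Y (e i)) (x2 (e i) X) +
    \sum_i g (x3 Y (e i)) (x3 (e i) X) + \sum_i g (x3 Y (e i)) (x4 (e i) X).
  by rewrite -!big_split; apply: eq_bigr => i _; rewrite !(gDr glin).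
have -> : \sum_i g (T (e i) X) (x3 (e i) Y) =
    \sum_i g (x1 (e i) X) (x3 (e i) Y) + \sum_i g (x2 (e i) X) (x3 (e i) Y) +
    \sum_i g (x3 (e i) X) (x3 (e i) Y) + \sum_i g (x4 (e i) X) (x3 (e i) Y).
  by rewrite -!big_split; apply: eq_bigr => i _; rewrite !(gDl glin).
have -> : \sum_i g (x3 (T (e i) X) Y) (e i) =
    \sum_i g (x3 (x1 (e i) X) Y) (e i) + \sum_i g (x3 (x2 (e i) X) Y) (e i) +
    \sum_i g (x3 (x3 (e i) X) Y) (e i) + \sum_i g (x3 (x4 (e i) X) Y) (e i).
  by rewrite -!big_split; apply: eq_bigr => i _; rewrite !(blinDl l3) !(gDl glin).
rewrite (pairing_type34 l3 l3 J3 X Y type3) (pairing_type34 l3 l4 J3 X Y type4).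
rewrite (pairing_W4 x4E X Y l3 sk3 J3).
rewrite (pairing_type12_type34 l3 l1 X Y type1 type3).
rewrite (pairing_type12_type34 l3 l2 X Y type2 type3).
rewrite (trace_comp_type12_type34 l3 l1 X Y type1 type3).
rewrite (trace_comp_type12_type34 l3 l2 X Y type2 type3).
have := pairing_cyclic l3 l2 sk3 sk2 X Y cyc2.
have := trace_comp_W4 x4E X Y l3 sk3 J3 type3 x3_trace.
have := pairing_left_W4 x4E X Y l3 sk3 J3 type3 x3_trace.
have -> : \sum_i g (x3 Y (e i)) (x1 (e i) X) = - pr x3 x1 Y X.
  by rewrite -sumrN; apply: eq_bigr => i _; rewrite (alt1 (e i)) (gNr glin).
lra.
Qed.

Lemma trJ (f : E -> E -> R) : blin (f : E -> E -> R^o) ->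
  \sum_i f (J (e i)) (e i) = - \sum_i f (e i) (J (e i)).
Proof. by move=> fl; exact: (tr_skew gC expand Jlin gJl fl). Qed.

Lemma Ddomega_trace X Y :
  \sum_i Ddomega X Y (e i) (J (e i)) = (2 - 2 * n) * Dt X Y.
Proof.
rewrite 2!big_split /= domega_W1_trace// domega_W3_trace//; last exact: W3_type34.
by rewrite !add0r (domega_W4_trace _ (lDt.1 X) trg).
Qed.

Lemma domega_trace Z : \sum_i domega Z (e i) (J (e i)) = (2 - 2 * n) * g t Z.
Proof.
rewrite 2!big_split /= domega_W1_trace// domega_W3_trace//.
by rewrite !add0r (domega_W4_trace _ (glin.1 t) trg).
Qed.

Lemma domega_torsion X Y :
  \sum_i domega (torsion X (e i)) Y (J (e i)) =
  \sum_i domega_W1 x1 (torsion X (e i)) Y (J (e i)) +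
  \sum_i domega_W3 x3 (torsion X (e i)) Y (J (e i)) - 2 * g t (T X Y) + g t (T Y X) +
  2^-1 * (n - 1) * g t X * g t Y + g (T (J t) X) (J Y).
Proof.
rewrite 2!big_split /= (trace_contraction_W4 t X Y lT torsion_sum_skew torsion_sum_anti_J).
have := congr1 (g ^~ X) torsion_sum_trace; rewrite !(gZl glin) => tX.
have -> : g (\sum_i T (e i) (e i)) X = 2^-1 * (n - 1) * g t X.
  by apply: (mulfI neq20); rewrite tX !mulrA divff// mul1r.
rewrite (gDr glin) (gNr glin); ring.
Qed.

(** Since [T (e i) (J (e i)) = - J (T (e i) (e i))], the torsion contracted with [omega] is
    [- (n - 1) J t]. *)
Lemma domega_trace_torsion X Y :
  \sum_i domega (torsion (e i) (J (e i))) X Y = - (n - 1) * domega (J t) X Y.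
Proof.
have phil : linear (fun v => domega v X Y : R^o).
  by rewrite /domega /domega_W1 /domega_W3 /domega_W4; prove_linear.
have fl : blin (fun u v => domega (T u v) X Y : R^o).
  by split=> w c u v /=; rewrite ?(blinPl lT) ?(blinPr lT); apply: phil.
transitivity (\sum_i domega (T (e i) (J (e i))) X Y -
    \sum_i domega (T (J (e i)) (e i)) X Y).
  by rewrite -sumrB; apply: eq_bigr => i _; exact: (linB phil).
rewrite (trJ fl) opprK.
have -> : \sum_i domega (T (e i) (J (e i))) X Y =
    - domega (J (\sum_i T (e i) (e i))) X Y.
  rewrite (lin_sum Jlin) (lin_sum phil) -sumrN; apply: eq_bigr => i _.
  by rewrite torsion_sum_anti_J; exact: (linN phil).
have := congr1 (fun v => domega (J v) X Y) torsion_sum_trace.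
rewrite !(linZ Jlin) !(linZ phil) /GRing.scale /= mulNr => <-; ring.
Qed.

(** This is [d theta] computed with a connection that has torsion; [s] below turns out to be
    [- <d theta, omega>]. *)
Let dt X Y := Dt X Y - Dt Y X + g t (torsion X Y).
Let s := \sum_i Dt (e i) (J (e i)).

Lemma sum_alternating (F1 F2 F3 F4 F5 F6 F7 F8 F9 F10 : I -> R) :
  \sum_i (F1 i - F2 i + F3 i - F4 i + F5 i - F6 i + F7 i + F8 i - F9 i + F10 i) =
  \sum_i F1 i - \sum_i F2 i + \sum_i F3 i - \sum_i F4 i + \sum_i F5 i -
  \sum_i F6 i + \sum_i F7 i + \sum_i F8 i - \sum_i F9 i + \sum_i F10 i.
Proof. by rewrite !big_split /= !sumrN. Qed.

(* The identity [d (d omega) = 0] on [(X, Y, e_i, J e_i)], summed over [i]. *)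
Lemma closed_contracted X Y :
  (2 - 2 * n) * dt X Y + 2 * \sum_i Ddomega (e i) X Y (J (e i))
  - 2 * \sum_i domega (torsion X (e i)) Y (J (e i))
  + 2 * \sum_i domega (torsion Y (e i)) X (J (e i))
  - (n - 1) * domega (J t) X Y = 0.
Proof.
have D1l c u u' v w : D1 (c *: u + u') v w = c *: D1 u v w + D1 u' v w.
  exact: (lD1' v w).
have D3l c u u' v w : D3 (c *: u + u') v w = c *: D3 u v w + D3 u' v w.
  exact: (lD3' v w).
have Dl : blin (fun u v => Ddomega u X Y v : R^o).
  rewrite /Ddomega /domega_W1 /domega_W3 /domega_W4; split=> w c u v /=.
    by have := lD1 w; have := lD3 w => l l'; push_linear; rewrite /GRing.scale /=; ring.
  by rewrite !D1l !D3l; push_linear; rewrite /GRing.scale /=; ring.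
have ol X' Y' : blin (fun u v => domega (torsion X' u) Y' v : R^o).
  by rewrite /domega /torsion /domega_W1 /domega_W3 /domega_W4; prove_blin.
have := sum_alternating (fun i => Ddomega X Y (e i) (J (e i)))
  (fun i => Ddomega Y X (e i) (J (e i))) (fun i => Ddomega (e i) X Y (J (e i)))
  (fun i => Ddomega (J (e i)) X Y (e i))
  (fun i => domega (torsion X Y) (e i) (J (e i)))
  (fun i => domega (torsion X (e i)) Y (J (e i)))
  (fun i => domega (torsion X (J (e i))) Y (e i))
  (fun i => domega (torsion Y (e i)) X (J (e i)))
  (fun i => domega (torsion Y (J (e i))) X (e i))
  (fun i => domega (torsion (e i) (J (e i))) X Y).
rewrite big1 => [|i _]; last exact: closed.
rewrite !Ddomega_trace domega_trace domega_trace_torsion.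
(* Terms differing by the exchange of [e i] and [J (e i)] become equal, whence the factors [2]. *)
rewrite (trJ Dl) (trJ (ol X Y)) (trJ (ol Y X)) /dt.
move: (\sum_i _) (\sum_i _) (\sum_i _) => a b c; lra.
Qed.

(* The right-hand sides of the theorem. *)
Let R11 X Y :=
  - (\sum_i g (D3 (e i) X Y) (e i)) + \sum_i g (D3 (e i) Y X) (e i)
  + (n - 2) / 2 * g (x3 X Y - x3 Y X) t
  - 3 / 2 * (\sum_i g (x1 X (e i)) (x2 Y (e i)))
  + 3 / 2 * (\sum_i g (x1 Y (e i)) (x2 X (e i))).

Let R20 X Y :=
  - 3 * (\sum_i g (D1 (e i) (e i) X) Y)
  + \sum_i g (D3 (e i) (e i) X) Y
  + \sum_i g (x3 X (e i)) (x1 Y (e i))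
  - \sum_i g (x3 Y (e i)) (x1 X (e i))
  - 1 / 2 * (\sum_i g (x3 X (e i)) (x2 Y (e i)))
  + 1 / 2 * (\sum_i g (x3 Y (e i)) (x2 X (e i)))
  + 3 * (n - 3) / 2 * g (x1 t X) Y
  - (n - 1) / 2 * g (x3 t X) Y.

Lemma domega_J_sharp X Y : domega (J t) X Y =
  - 6 * g (x1 t X) Y + 2 * (g (x3 t X) Y - g t (x3 X Y) + g t (x3 Y X)).
Proof.
have tJ : g t (J t) = 0 by apply: eq_opp0; rewrite {1}J_adj gC.
rewrite /domega /domega_W1 /domega_W3 /domega_W4 type1 type3 J3 JJ tJ (gNl glin) !gJ !(gNr glin).
by rewrite (gNl glin) gJ (sk3 Y t) (gC (x3 X Y)) (gC Y t); ring.
Qed.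

(** The W2 part is a cyclic sum and vanishes by [cyc2]; the W4 part vanishes by its explicit
    formula. *)
Lemma torsion_sharp X Y : g t (T X Y) - g t (T Y X) - g (T (J t) X) (J Y) =
  3 * g (x1 t X) Y + g t (x3 X Y) - g t (x3 Y X) - g (x3 t X) Y.
Proof.
have x1X : g t (x1 X Y) = g (x1 t X) Y.
  by rewrite (alt1 t) (gNl glin) (sk1 X t) opprK.
have x1Y : g t (x1 Y X) = - g (x1 t X) Y.
  by rewrite (alt1 Y) (gNr glin) x1X.
have x2XY : g t (x2 X Y) - g t (x2 Y X) + g (x2 t X) Y = 0.
  by have := cyc2 X Y t; rewrite (gC (x2 X Y)) (sk2 Y t) => <-; ring.
have x4XY : g t (x4 X Y) - g t (x4 Y X) - g (x4 t X) Y = 0.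
  have := g_W4 x4E X Y t; have := g_W4 x4E Y X t; have := g_W4 x4E t X Y.
  have tJ : g (J t) t = 0 by apply: eq_opp0; rewrite {1}gJl gC.
  have JYX : g (J Y) X = - g (J X) Y by rewrite gJl gC.
  rewrite tJ JYX !(gJl t) (gC (J X) t) (gC (J Y) t) (gC X t) (gC Y t) (gC Y X).
  rewrite !(gC t (x4 _ _)); lra.
rewrite /torsion_sum !(gDr glin) !(gDl glin) type1 type2 type3 type4.
rewrite !(gNl glin) !gJ; lra.
Qed.

(** In [closed_contracted] the part [theta /\ omega] yields [(2 - 2 n) dt] by its trace and, up to
    torsion, [2 dt] by its divergence; dividing by [- 4] gives [(n - 2) / 2]. Pairings of [x1] with
    itself and of [x3] with itself are symmetric in [X] and [Y] and cancel. *)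
Lemma lee_differential X Y :
  (n - 2) / 2 * dt X Y - s / 2 * g X (J Y) = R11 X Y + R20 X Y.
Proof.
have D : \sum_i Ddomega (e i) X Y (J (e i)) =
    - 6 * \sum_i g (D1 (e i) (e i) X) Y +
    2 * (\sum_i g (D3 (e i) Y X) (e i) - \sum_i g (D3 (e i) X Y) (e i) +
      \sum_i g (D3 (e i) (e i) X) Y) + (Dt X Y - Dt Y X + s * g X (J Y)).
  rewrite 2!big_split /= (domega_W1_divergence X Y skD1) => [|u v w]; last exact: W1_alternating.
  rewrite (domega_W3_divergence X Y skD3 JD3) ?(domega_W4_divergence X Y lDt)//.
  by move=> w; exact: W3_type34.
have swapt : g (T (J t) Y) (J X) = - g (T (J t) X) (J Y).
  by rewrite (torsion_sum_skew _ Y) torsion_sum_anti_J (gNr glin) opprK gC gJl.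
have torE : g t (torsion X Y) = g t (T X Y) - g t (T Y X).
  by rewrite (gDr glin) (gNr glin).
have F33 : \sum_i g (x3 (x3 (e i) X) Y) (e i) = \sum_i g (x3 (x3 (e i) Y) X) (e i).
  exact: (tr_comm glin expand (l3.2 Y) (l3.2 X)).
have prC S S' U V : pr S S' U V = pr S' S V U.
  by apply: eq_bigr => i _; exact: gC.
have L33 : \sum_i g (x3 (e i) X) (x3 (e i) Y) = \sum_i g (x3 (e i) Y) (x3 (e i) X).
  by apply: eq_bigr => i _; exact: gC.
have x1X : g (x1 X Y) t = g (x1 t X) Y.
  by rewrite (alt1 t) (gNl glin) (sk1 X t) opprK gC.
have x1Y : g (x1 Y X) t = - g (x1 t X) Y by rewrite (alt1 Y) (gNl glin) x1X.
have x3t : g (x3 t Y) X = - g (x3 t X) Y by rewrite (sk3 t Y) gC.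
have := closed_contracted X Y; have := torsion_sharp X Y.
rewrite D !domega_torsion !domega_W1_torsion !domega_W3_torsion domega_J_sharp swapt.
rewrite F33 L33 x1X x1Y x3t /R11 /R20 /dt torE.
have -> : g (x3 X Y - x3 Y X) t = g (x3 X Y) t - g (x3 Y X) t.
  by rewrite (gDl glin) (gNl glin).
rewrite !(gC t (x3 _ _)) (prC x1 x1 Y X) (prC x3 x3 Y X).
rewrite (prC x1 x3 X Y) (prC x1 x3 Y X).
move: (g (T (J t) X) (J Y)) => w; rewrite (mulrC (2^-1 * (n - 1) * g t Y)).
rewrite -!mulrA; lra.
Qed.

Lemma R11_J X Y : R11 (J X) (J Y) = R11 X Y.
Proof.
have tr3 U V : \sum_i g (D3 (e i) (J U) (J V)) (e i) = \sum_i g (D3 (e i) U V) (e i).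
  by apply: eq_bigr => i _; rewrite D3_JJ.
have pr12 U V : pr x1 x2 (J U) (J V) = pr x1 x2 U V.
  by apply: eq_bigr => i _; rewrite type1 type2 (gNl glin) (gNr glin) opprK gJ.
by rewrite /R11 !tr3 !pr12 !x3_JJ.
Qed.

Lemma R20_J X Y : R20 (J X) (J Y) = - R20 X Y.
Proof.
have trD (D : E -> E -> E -> E) U V : (forall u, anti_J (D u)) ->
    \sum_i g (D (e i) (e i) (J U)) (J V) = - \sum_i g (D (e i) (e i) U) V.
  by move=> JD; rewrite -sumrN; apply: eq_bigr => i _; rewrite JD (gNl glin) gJ.
have pr3 S U V : (forall u v, S (J u) v = - J (S u v)) ->
    pr x3 S (J U) (J V) = - pr x3 S U V.
  move=> type; rewrite -sumrN; apply: eq_bigr => i _.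
  by rewrite type3 type (gNr glin) gJ.
rewrite /R20 !trD// !(pr3 x1)// !(pr3 x2)// J1 J3 !(gNl glin) !gJ; ring.
Qed.

Lemma dt_blin : blin (dt : E -> E -> R^o).
Proof. by rewrite /dt /torsion; prove_blin. Qed.

(** The torsion term contracts to a multiple of [g t (J t)], which is zero. *)
Lemma sum_dt_J : \sum_i dt (e i) (J (e i)) = 2 * s.
Proof.
have fl : blin (fun u v => g t (T u v) : R^o) by prove_blin.
rewrite /dt big_split sumrB /= (trJ lDt) -/s.
have -> : \sum_i g t (torsion (e i) (J (e i))) = 0; last by ring.
transitivity (\sum_i g t (T (e i) (J (e i))) - \sum_i g t (T (J (e i)) (e i))).
  by rewrite -sumrB; apply: eq_bigr => i _; rewrite (gDr glin) (gNr glin).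
rewrite (trJ fl) opprK.
rewrite (eq_bigr (fun i => - g t (J (T (e i) (e i))))) => [|i _]; last first.
  by rewrite torsion_sum_anti_J (gNr glin).
have gtJ : linear (fun v => g t (J v) : R^o) by prove_linear.
rewrite sumrN -(lin_sum gtJ); have := congr1 (fun v => g t (J v)) torsion_sum_trace.
rewrite !(linZ Jlin) !(gZr glin).
have -> : g t (J t) = 0 by apply: eq_opp0; rewrite {1}J_adj gC.
lra.
Qed.

(* By [pairing_cyclic] for [x1] and [J x2], the sum is minus twice itself. *)
Lemma sum_pairing_x1_Jx2 :
  \sum_i \sum_j g (x1 (e i) (e j)) (J (x2 (e i) (e j))) = 0.
Proof.
pose y u v := J (x2 u v).
have ly : blin y by split=> ? c u v; rewrite /y /=; push_linear.
have sky : skew_valued y by move=> u v w; rewrite /y gJl sk2 J2 (gNr glin) opprK.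
have cycy u v w : g (y u v) w + g (y v w) u + g (y w u) v = 0.
  by rewrite /y !gJl -!opprD x2_cyc oppr0.
set z := \sum_i _; suff : z = - (2 * z) by lra.
have zE : \sum_i \sum_j g (x1 (e i) (e j)) (y (e j) (e i)) = - z.
  rewrite exchange_big -sumrN; apply: eq_bigr => i _.
  by rewrite -sumrN; apply: eq_bigr => j _; rewrite alt1 (gNl glin).
rewrite -mulrN -zE mulr_sumr; apply: eq_bigr => i _.
exact: (pairing_cyclic l1 ly sk1 sky (e i) (e i) cycy).
Qed.

(** Once [J] is pulled out of each term, what remains are the traces of [D3] and [x3], both zero,
    and the pairing of [x1] with [J x2]. *)
Lemma sum_R11_J : \sum_i R11 (e i) (J (e i)) = 0.
Proof.
transitivity (\sum_i (2 * \sum_j g (J (D3 (e j) (e i) (e i))) (e j)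
    - (n - 2) * g (J (x3 (e i) (e i))) t
    + 3 * \sum_j g (x1 (e i) (e j)) (J (x2 (e i) (e j))))).
  apply: eq_bigr => i _; rewrite /R11.
  have -> : \sum_j g (D3 (e j) (e i) (J (e i))) (e j) =
      - \sum_j g (J (D3 (e j) (e i) (e i))) (e j).
    by rewrite -sumrN; apply: eq_bigr => j _; rewrite JD3 (gNl glin).
  have -> : \sum_j g (D3 (e j) (J (e i)) (e i)) (e j) =
      \sum_j g (J (D3 (e j) (e i) (e i))) (e j).
    by apply: eq_bigr => j _; rewrite (W3_type34 (JD3 _) (D3_JJ _)).
  have -> : \sum_j g (x1 (e i) (e j)) (x2 (J (e i)) (e j)) =
      - \sum_j g (x1 (e i) (e j)) (J (x2 (e i) (e j))).
    by rewrite -sumrN; apply: eq_bigr => j _; rewrite type2 (gNr glin).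
  have -> : \sum_j g (x1 (J (e i)) (e j)) (x2 (e i) (e j)) =
      \sum_j g (x1 (e i) (e j)) (J (x2 (e i) (e j))).
    by apply: eq_bigr => j _; rewrite type1 (gNl glin) gJl opprK.
  by rewrite J3 type3 (gDl glin) (gNl glin); field.
rewrite big_split sumrB /= -!mulr_sumr sum_pairing_x1_Jx2 exchange_big /=.
have gJl' w : linear (fun v => g (J v) w : R^o) by prove_linear.
rewrite big1 => [|j _]; last first.
  by rewrite -(lin_sum (gJl' _)) D3_trace (lin0 (gJl' _)).
by rewrite -(lin_sum (gJl' _)) x3_trace (lin0 (gJl' _)); ring.
Qed.

(** The identity is summed over [(e i, J (e i))] and over the same pairs rotated by [J]. The left
    sides agree while [R20] changes sign, so adding the two leaves only [R11]. *)
Lemma dt_kahler_trace_eq0 : n != 1 -> s = 0.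
Proof.
move=> n1.
have lee (X Y : I -> E) : \sum_i (R11 (X i) (Y i) + R20 (X i) (Y i)) =
    (n - 2) / 2 * \sum_i dt (X i) (Y i) - s / 2 * \sum_i g (X i) (J (Y i)).
  by rewrite !mulr_sumr -sumrB; apply: eq_bigr => i _; rewrite lee_differential.
have := lee e (fun i => J (e i)); have := lee (fun i => J (e i)) (fun i => J (J (e i))).
have dl := dt_blin; have fl : blin (fun u v => dt u (J v) : R^o) by prove_blin.
have gl : blin (fun u v => g u (J (J v)) : R^o) by prove_blin.
rewrite (trJJ fl) (trJJ gl) /= sum_dt_J.
have -> : \sum_i g (e i) (J (J (e i))) = - (2 * n).
  by rewrite -trg -sumrN; apply: eq_bigr => i _; rewrite JJ (gNr glin).
rewrite (eq_bigr (fun i => R11 (e i) (J (e i)) - R20 (e i) (J (e i)))) => [|i _].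
  have -> : \sum_i (R11 (e i) (J (e i)) + R20 (e i) (J (e i))) =
    \sum_i R11 (e i) (J (e i)) + \sum_i R20 (e i) (J (e i)) by exact: big_split.
  have -> : \sum_i (R11 (e i) (J (e i)) - R20 (e i) (J (e i))) =
    \sum_i R11 (e i) (J (e i)) - \sum_i R20 (e i) (J (e i)) by exact: sumrB.
  rewrite sum_R11_J => E1 E2.
  have : (n - 1) * s = 0 by lra.
  by move/eqP; rewrite mulf_eq0 subr_eq0 (negPf n1) => /eqP.
by rewrite R11_J R20_J.
Qed.

Lemma inner_dt_kahler : n != 1 ->
  \sum_i \sum_j dt (e i) (e j) * g (e i) (J (e j)) = 0.
Proof.
move=> n1; have dl := dt_blin.
rewrite exchange_big (eq_bigr (fun j => dt (J (e j)) (e j))) => [|j _].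
  by rewrite (trJ dl) sum_dt_J (dt_kahler_trace_eq0 n1) mulr0 oppr0.
rewrite -(sum_contract expand (J (e j)) (dl.2 (e j))).
by apply: eq_bigr => i _; rewrite gC mulrC.
Qed.

Lemma lee_differential_11 X Y : n != 1 ->
  (n - 2) / 2 * (2^-1 * (dt X Y + dt (J X) (J Y))) = R11 X Y.
Proof.
move=> n1; have := lee_differential X Y; have := lee_differential (J X) (J Y).
rewrite R11_J R20_J (dt_kahler_trace_eq0 n1); lra.
Qed.

Lemma lee_differential_20 X Y : n != 1 ->
  (n - 2) / 2 * (2^-1 * (dt X Y - dt (J X) (J Y))) = R20 X Y.
Proof.
move=> n1; have := lee_differential X Y; have := lee_differential (J X) (J Y).
rewrite R11_J R20_J (dt_kahler_trace_eq0 n1); lra.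
Qed.

Lemma lee_differential_components X Y : n != 1 ->
  [/\ \sum_i \sum_j dt (e i) (e j) * g (e i) (J (e j)) = 0,
      (n - 2) / 2 * (2^-1 * (dt X Y + dt (J X) (J Y))) = R11 X Y &
      (n - 2) / 2 * (2^-1 * (dt X Y - dt (J X) (J Y))) = R20 X Y].
Proof.
by move=> n1; split; [exact: inner_dt_kahler|exact: lee_differential_11|
  exact: lee_differential_20].
Qed.

Lemma form_skew S X Y Z : skew_valued S -> anti_J S ->
  g (S X Z) (J Y) = - g (S X Y) (J Z).
Proof. by move=> sk aJ; rewrite sk aJ (gNr glin) opprK J_adj gC J_adj opprK. Qed.

(** The left side is [d omega] on constant fields, differentiated with [G]. The symmetric part [Gs]
    cancels, leaving twice the cyclic sum of [g (T X Y) (J Z)]; for [x1] its three terms coincide,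
    whence the [6] in [domega_W1]. *)
Lemma domegaE (G Gs : E -> E -> E) X Y Z :
  (forall u v, G u v = Gs u v + T u v) -> (forall u v, Gs u v = Gs v u) ->
  g (G X Y) (J Z) + g Y (J (G X Z)) + (g (G Y Z) (J X) + g Z (J (G Y X))) +
  (g (G Z X) (J Y) + g X (J (G Z Y))) = domega X Y Z.
Proof.
move=> GE Gsym.
have swap U A : g U (J A) = - g A (J U) by rewrite J_adj gC.
rewrite !(swap _ (G _ _)) !GE !(gDl glin (Gs _ _)) (Gsym Y X) (Gsym Z X) (Gsym Z Y).
have [sT aT] := (torsion_sum_skew, torsion_sum_anti_J).
rewrite (form_skew X Y Z sT aT) (form_skew Y Z X sT aT) (form_skew Z X Y sT aT).
rewrite /torsion_sum !(gDl glin).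
have b1 U W A : g (x1 U W) (J A) = g (x1 W A) (J U).
  by rewrite (alt1 U) (gNl glin) (form_skew _ _ _ sk1 J1) opprK.
have c2 := x2_cyc X Y Z.
have f4 U W A := g_W4 x4E U W (J A).
have := f4 X Y Z; have := f4 Y Z X; have := f4 Z X Y.
rewrite /domega /domega_W1 /domega_W3 /domega_W4 !gJ (b1 Z) (b1 X) (b1 Y).
rewrite !(gC (J _)) (swap Z Y) (swap X Z) (swap Y X) (gC Z Y) (gC Z X) (gC Y X).
move: c2; lra.
Qed.

Lemma domega_swap12 X Y Z : domega X Y Z = - domega Y X Z.
Proof.
have swap U A : g U (J A) = - g A (J U) by rewrite J_adj gC.
rewrite /domega /domega_W1 /domega_W3 /domega_W4 (alt1 Y) (gNl glin) (form_skew Y X Z sk3 J3).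
rewrite (form_skew X Y Z sk3 J3) (form_skew Z X Y sk3 J3).
rewrite (swap Y X) (swap X Z) (swap Z Y); ring.
Qed.

Lemma domega_swap23 X Y Z : domega X Y Z = - domega X Z Y.
Proof.
have swap U A : g U (J A) = - g A (J U) by rewrite J_adj gC.
rewrite /domega /domega_W1 /domega_W3 /domega_W4 (form_skew X Y Z sk1 J1) (form_skew Y Z X sk3 J3).
rewrite (form_skew X Y Z sk3 J3) (form_skew Z X Y sk3 J3).
rewrite (swap Y X) (swap X Z) (swap Z Y); ring.
Qed.

Lemma domega_linear Y Z : linear (fun v => domega v Y Z : R^o).
Proof. by rewrite /domega /domega_W1 /domega_W3 /domega_W4; prove_linear. Qed.

(** As [domega] is alternating, the terms with [G u v] and [G v u] can be brought to the same slots,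
    where their difference is the torsion. *)
Lemma closed_of_derivative (G Gs : E -> E -> E) X Y Z W :
  (forall u v, G u v = Gs u v + T u v) -> (forall u v, Gs u v = Gs v u) ->
  let Dal u X Y Z := Ddomega u X Y Z + domega (G u X) Y Z +
    domega X (G u Y) Z + domega X Y (G u Z) in
  Dal X Y Z W - Dal Y X Z W + Dal Z X Y W - Dal W X Y Z = 0 ->
  Ddomega X Y Z W - Ddomega Y X Z W + Ddomega Z X Y W - Ddomega W X Y Z
  + domega (torsion X Y) Z W - domega (torsion X Z) Y W
  + domega (torsion X W) Y Z + domega (torsion Y Z) X W
  - domega (torsion Y W) X Z + domega (torsion Z W) X Y = 0.
Proof.
move=> GE Gsym Dal.
have tor u v A B : domega (torsion u v) A B = domega (G u v) A B - domega (G v u) A B.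
  rewrite -(linB (domega_linear A B)); congr (domega _ A B).
  by rewrite !GE (Gsym v u) opprD addrACA subrr add0r.
rewrite /Dal !tor.
rewrite (domega_swap12 Y (G X Z)) (domega_swap23 Y Z (G X W)) (domega_swap12 Y (G X W)).
rewrite (domega_swap12 X (G Y Z)) (domega_swap23 X Z (G Y W)) (domega_swap12 X (G Y W)).
rewrite (domega_swap12 X (G Z Y)) (domega_swap23 X Y (G Z W)) (domega_swap12 X (G Z W)).
rewrite (domega_swap12 X (G W Y)) (domega_swap23 X Y (G W Z)) (domega_swap12 X (G W Z)).
lra.
Qed.

End DifferentialOfLeeForm.
End HermitianTraces.

(** * Covariant derivatives in a chart *)

Section Leibniz.
Context {R : realType} {U : normedModType R} {m : nat}.
Local Notation E := 'rV[R]_m.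
Implicit Types (x u : U) (P Q : U -> E).

Lemma is_derive_row k (F : U -> 'rV[R]_k) x u (d : 'rV[R]_k) :
  (forall j, is_derive x u (fun y => F y 0 j) (d 0 j)) -> is_derive x u F d.
Proof.
move=> Fd; have dF : derivable F x u.
  by apply/derivable_mxP => i j; rewrite ord1; have [] := Fd j.
apply: DeriveDef => //; rewrite (derive_mx dF); apply/rowP => j.
by rewrite mxE; have [] := Fd j.
Qed.

Lemma derivable_coord k (P : U -> 'rV[R]_k) x u j :
  derivable P x u -> derivable (fun y => P y 0 j) x u.
Proof. by move=> dP; exact: (derivable_mxP P x u).1 dP 0 j. Qed.

Lemma derive_coord k (P : U -> 'rV[R]_k) x u j : derivable P x u ->
  'D_u (fun y => P y 0 j) x = 'D_u P x 0 j.
Proof. by move=> dP; rewrite (derive_mx dP) mxE. Qed.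

Lemma lin_row (f : E -> R) v : linear (f : E -> R^o) ->
  f v = \sum_j v 0 j * f (delta_mx 0 j).
Proof.
move=> lf; rewrite [in LHS](row_sum_delta v) (lin_sum lf).
by apply: eq_bigr => j _; rewrite (linZ lf).
Qed.

Section Scalar.
Variables (L : U -> E -> R) (x u : U).
Hypothesis L_lin : \forall y \near x, linear (L y : E -> R^o).
Hypothesis L_der : forall w, derivable (L ^~ w) x u.

Let is_derive_expand P : derivable P x u ->
  is_derive x u (fun y => L y (P y))
    (\sum_j (P x 0 j * 'D_u (L ^~ (delta_mx 0 j)) x +
             L x (delta_mx 0 j) * 'D_u P x 0 j)).
Proof.
move=> dP; pose F (j : 'I_m) := (fun y => P y 0 j) * (L ^~ (delta_mx 0 j)).
apply: (@near_eq_is_derive _ _ _ (\sum_j F j)).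
  by apply: filterS L_lin => y Ly; rewrite (lin_row _ Ly) fct_sumE.
apply: is_derive_sum => j; rewrite -(derive_coord j dP).
by apply: is_deriveM; apply: derivableP => //; exact: derivable_coord.
Qed.

Lemma is_derive_linear_family P : derivable P x u ->
  is_derive x u (fun y => L y (P y)) ('D_u (L ^~ (P x)) x + L x ('D_u P x)).
Proof.
move=> dP; have [d1 E1] := is_derive_expand dP.
apply: DeriveDef => //; rewrite E1.
(* The expansion for the constant [P x] identifies the first half of the sum with the derivative of
   [L] at a fixed vector. *)
have [_ E2] := is_derive_expand (derivable_cst (P x) x u).
rewrite [in RHS]E2 (lin_row ('D_u P x) (nbhs_singleton L_lin)) -big_split /=.
by apply: eq_bigr => j _; rewrite derive_cst mxE mulr0 addr0 mulrC [L _ _ * _]mulrC.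
Qed.

End Scalar.

Lemma is_derive_linear_familyV k (L : U -> E -> 'rV[R]_k) x u P :
  (\forall y \near x, linear (L y)) -> (forall w, derivable (L ^~ w) x u) ->
  derivable P x u ->
  is_derive x u (fun y => L y (P y)) ('D_u (L ^~ (P x)) x + L x ('D_u P x)).
Proof.
move=> L_lin L_der dP; apply: is_derive_row => j.
rewrite [X in is_derive _ _ _ X]mxE -(derive_coord j (L_der (P x))).
apply: (@is_derive_linear_family (fun y w => L y w 0 j)) => //.
  by apply: filterS L_lin => y Ly c v w; rewrite Ly !mxE.
by move=> w; exact: derivable_coord.
Qed.

Lemma is_derive_bilinear_family (B : U -> E -> E -> R) x u P Q :
  (\forall y \near x, blin (B y : E -> E -> R^o)) ->
  (forall v w, derivable (fun y => B y v w) x u) ->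
  derivable P x u -> derivable Q x u ->
  is_derive x u (fun y => B y (P y) (Q y))
    ('D_u (fun y => B y (P x) (Q x)) x + B x ('D_u P x) (Q x) +
     B x (P x) ('D_u Q x)).
Proof.
move=> B_lin B_der dP dQ.
have Bl w : is_derive x u (fun y => B y (P y) w)
    ('D_u (fun y => B y (P x) w) x + B x ('D_u P x) w).
  apply: (@is_derive_linear_family (fun y v => B y v w)) => //.
  by apply: filterS B_lin => y [_]; apply.
have [_ E] := Bl (Q x); rewrite -E.
apply: (@is_derive_linear_family (fun y w => B y (P y) w)) => //.
by apply: filterS B_lin => y [+ _]; apply.
Qed.

Lemma is_derive_bilinear_familyV k (B : U -> E -> E -> 'rV[R]_k) x u P Q :
  (\forall y \near x, blin (B y)) ->
  (forall v w, derivable (fun y => B y v w) x u) ->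
  derivable P x u -> derivable Q x u ->
  is_derive x u (fun y => B y (P y) (Q y))
    ('D_u (fun y => B y (P x) (Q x)) x + B x ('D_u P x) (Q x) +
     B x (P x) ('D_u Q x)).
Proof.
move=> B_lin B_der dP dQ; apply: is_derive_row => j.
rewrite [X in is_derive _ _ _ X]mxE [X in X + _]mxE -(derive_coord j (B_der _ _)).
apply: (@is_derive_bilinear_family (fun y v w => B y v w 0 j)) => //.
  by apply: filterS B_lin => y [B1 B2]; split=> ? c v w; rewrite /= (B1, B2) !mxE.
by move=> v w; exact: derivable_coord.
Qed.

End Leibniz.

Section DeriveScalar.
Context {R : realType} {U : normedModType R}.
Implicit Types (f h : U -> R) (x u : U).

Lemma is_derive_addf f h x u df dh : is_derive x u f df -> is_derive x u h dh ->
  is_derive x u (fun y => f y + h y) (df + dh).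
Proof. exact: is_deriveD. Qed.

Lemma is_derive_mulf f h x u df dh : is_derive x u f df -> is_derive x u h dh ->
  is_derive x u (fun y => f y * h y) (df * h x + f x * dh).
Proof. by move=> Df Dh; apply: is_derive_eq (is_deriveM Df Dh) _; rewrite addrC [_ *: df]mulrC. Qed.

Lemma is_derive_cstmulf c f x u df : is_derive x u f df ->
  is_derive x u (fun y => c * f y) (c * df).
Proof. exact: is_deriveZ. Qed.

End DeriveScalar.

Lemma smooth_derive_linear (R : realType) (U : normedModType R) (V : set U) k
    (f : U -> 'rV[R]_k) x : open V -> V x -> smooth_on V f ->
  linear (fun u => 'D_u f x).
Proof.
move=> oV Vx sf c u v.
have df w : derivable f x w by have [_ /(_ w)[+ _]] := sf 1%N; apply.
have sfj j : smooth_on V (fun y => f y 0 j) by move=> l; exact: Ck_on_coord.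
apply/rowP => j; rewrite !mxE -!derive_coord//.
by rewrite (smooth_deriveD oV (sfj j))// (smooth_deriveZ (sfj j)).
Qed.

(** [h s t u v] stands for the second derivative along [s] and [t] of the component [w u v] of a
    two-form; the twelve terms cancel in pairs. *)
Lemma alternating_sum_eq0 (R : realType) (U : Type) (h : U -> U -> U -> U -> R) X Y Z W :
  (forall s t u v, h s t u v = - h s t v u) ->
  (forall s t u v, h s t u v = h t s u v) ->
  h X Y Z W + h X Z W Y + h X W Y Z - (h Y X Z W + h Y Z W X + h Y W X Z) +
  (h Z X Y W + h Z Y W X + h Z W X Y) - (h W X Y Z + h W Y Z X + h W Z X Y) = 0.
Proof.
move=> sk cm; rewrite (cm W Z) (cm W Y) (cm W X) (cm Z Y) (cm Z X) (cm Y X).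
rewrite (sk Y W Z X) (sk X Z W Y); ring.
Qed.

Lemma d_squared (R : realType) (U : normedModType R) (V : set U)
    (w : U -> U -> U -> R) x X Y Z W : open V -> V x ->
  (forall u v, Ck_on V 2 (w u v)) ->
  (forall u v y, V y -> w u v y = - w v u y) ->
  let dw y u v t := 'D_u (w v t) y + 'D_v (w t u) y + 'D_t (w u v) y in
  'D_X (fun y => dw y Y Z W) x - 'D_Y (fun y => dw y X Z W) x
  + 'D_Z (fun y => dw y X Y W) x - 'D_W (fun y => dw y X Y Z) x = 0.
Proof.
move=> oV Vx Cw skw dw.
have d1 u v t y : V y -> derivable (w u v) y t.
  by move=> Vy; have [_ /(_ t)[+ _]] := Cw u v; apply.
have d2 u v t s : derivable ('D_t (w u v)) x s.
  by have [_ /(_ t)[_ [_ /(_ s)[+ _]]]] := Cw u v; apply.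
have Ddw s u v t : 'D_s (fun y => dw y u v t) x =
    'D_s ('D_u (w v t)) x + 'D_s ('D_v (w t u)) x + 'D_s ('D_t (w u v)) x.
  have [_ <-] := is_derive_addf (is_derive_addf (derivableP (d2 v t u s))
    (derivableP (d2 t u v s))) (derivableP (d2 u v t s)).
  by [].
have sk s t u v : 'D_s ('D_t (w u v)) x = - 'D_s ('D_t (w v u)) x.
  rewrite -deriveN//; apply: near_eq_derive; apply: (near_open oV Vx) => y Vy.
  rewrite /GRing.opp /= -deriveN; last exact: d1.
  by apply: near_eq_derive; apply: (near_open oV Vy) => z Vz; rewrite skw.
have cm s t u v := C2_derive_comm oV s t (Cw u v) Vx.
rewrite !Ddw; exact: (alternating_sum_eq0 (h := fun s t u v => 'D_s ('D_t (w u v)) x)).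
Qed.

Lemma derive_lincomb (R : realType) (U W : normedModType R) (V : set U)
    (f f1 f2 : U -> W) c x u : open V -> V x ->
  (forall y, V y -> f y = c *: f1 y + f2 y) ->
  derivable f1 x u -> derivable f2 x u ->
  'D_u f x = c *: 'D_u f1 x + 'D_u f2 x.
Proof.
move=> oV Vx fE d1 d2.
have [_ <-] := is_deriveD (is_deriveZ c (derivableP d1)) (derivableP d2).
by apply: near_eq_derive; exact: (near_open oV Vx).
Qed.

(** * Differentiation by a connection preserving the metric and the almost complex structure *)

Section ParallelStructure.
Context {R : realType} {m : nat}.
Local Notation E := 'rV[R]_m.
Variables (V : set E) (g : E -> E -> E -> R) (J : E -> E -> E)
  (G : E -> E -> E -> E).
Hypothesis oV : open V.
Hypothesis g_blin : forall y, V y -> blin (g y : E -> E -> R^o).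
Hypothesis gC : forall y v w, V y -> g y v w = g y w v.
Hypothesis g_der : forall y u v w, V y -> derivable (fun z => g z v w) y u.
Hypothesis g_par : forall y u v w, V y ->
  'D_u (fun z => g z v w) y - g y (G y u v) w - g y v (G y u w) = 0.
Hypothesis J_lin : forall y, V y -> linear (J y).
Hypothesis J_der : forall y u v, V y -> derivable (fun z => J z v) y u.
Hypothesis J_par : forall y u v, V y ->
  'D_u (fun z => J z v) y + G y u (J y v) - J y (G y u v) = 0.
Hypothesis G_blin : forall y, V y -> blin (G y).

(** A relation rather than a function, so that derivability is carried along with the value of the
    covariant derivative of [P]. *)
Definition has_cov (P : E -> E) (x u d : E) : Prop :=
  derivable P x u /\ 'D_u P x + G x u (P x) = d.

Definition cov2 (T : E -> E -> E -> E) x u v w :=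
  'D_u (fun y => T y v w) x + G x u (T x v w) - T x (G x u v) w - T x v (G x u w).

Section AtPoint.
Variables (x u : E).
Hypothesis Vx : V x.

Lemma has_cov_cst v : has_cov (cst v) x u (G x u v).
Proof. by split; [exact: derivable_cst|rewrite derive_cst add0r]. Qed.

(** This is how an identity between fields is differentiated: compute [has_cov] of both sides and
    compare. *)
Lemma has_cov_unique P Q d d' : (forall y, V y -> P y = Q y) ->
  has_cov P x u d -> has_cov Q x u d' -> d = d'.
Proof.
move=> PQ [_ E1] [_ E2]; apply: etrans (esym E1) (etrans _ E2).
congr (_ + G x u _).
  by apply: near_eq_derive; exact: (near_open oV Vx).
exact: PQ.
Qed.

Lemma has_covD P Q d d' : has_cov P x u d -> has_cov Q x u d' ->
  has_cov (P + Q) x u (d + d').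
Proof.
move=> [dP <-] [dQ <-]; split; first exact: derivableD.
by rewrite deriveD// (blinDr (G_blin Vx)) addrACA.
Qed.

Lemma has_cov_sum (I : Type) (r : seq I) (P : I -> E -> E) (d : I -> E) :
  (forall i, has_cov (P i) x u (d i)) ->
  has_cov (\sum_(i <- r) P i) x u (\sum_(i <- r) d i).
Proof.
move=> Pd; elim/big_rec2: _ => [|i d' P' _]; last exact: has_covD.
by rewrite -[X in has_cov _ _ _ X](lin0 ((G_blin Vx).1 u)); exact: has_cov_cst.
Qed.

Lemma has_covN P d : has_cov P x u d -> has_cov (- P) x u (- d).
Proof.
move=> [dP <-]; split; first exact: derivableN.
by rewrite deriveN// (blinNr (G_blin Vx)) opprD.
Qed.

Lemma has_cov_J P d : has_cov P x u d -> has_cov (fun y => J y (P y)) x u (J x d).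
Proof.
move=> [dP <-].
have [|w|dJP E] := @is_derive_linear_familyV _ _ _ _ J x u P _ _ dP.
- exact: (near_open oV Vx).
- exact: J_der.
split=> //; rewrite E (linD (J_lin Vx)) addrAC -[RHS]addrC; congr (_ + _).
by apply/eqP; rewrite -subr_eq0; apply/eqP; exact: J_par.
Qed.

Lemma is_derive_g P Q d d' : has_cov P x u d -> has_cov Q x u d' ->
  is_derive x u (fun y => g y (P y) (Q y)) (g x d (Q x) + g x (P x) d').
Proof.
move=> [dP <-] [dQ <-].
have H : \forall y \near x, blin (g y : E -> E -> R^o) by exact: (near_open oV Vx).
have [dB E] := is_derive_bilinear_family H (fun v w => @g_der x u v w Vx) dP dQ.
apply: DeriveDef => //; rewrite E (gDl (g_blin Vx)) (gDr (g_blin Vx)).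
by have := @g_par x u (P x) (Q x) Vx; lra.
Qed.

Section Tensor.
Variable T : E -> E -> E -> E.
Hypothesis T_blin : forall y, V y -> blin (T y).
Hypothesis T_der : forall y u v w, V y -> derivable (fun z => T z v w) y u.

Lemma has_cov_T P Q d d' : has_cov P x u d -> has_cov Q x u d' ->
  has_cov (fun y => T y (P y) (Q y)) x u
    (cov2 T x u (P x) (Q x) + T x d (Q x) + T x (P x) d').
Proof.
move=> [dP <-] [dQ <-].
have H : \forall y \near x, blin (T y) by exact: (near_open oV Vx).
have [dB E] := is_derive_bilinear_familyV H (fun v w => @T_der x u v w Vx) dP dQ.
split=> //; rewrite E (blinDl (T_blin Vx)) (blinDr (T_blin Vx)) /cov2.
by apply/rowP => j; rewrite !mxE; ring.
Qed.

Lemma cov2_blin : blin (cov2 T x u).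
Proof.
have Tl := T_blin Vx; have Gl := G_blin Vx.
split=> w c v v' /=; rewrite /cov2.
  rewrite (_ : 'D_u (fun y => T y w (c *: v + v')) x =
    c *: 'D_u (fun y => T y w v) x + 'D_u (fun y => T y w v') x).
    by push_linear; apply/rowP => j; rewrite !mxE; ring.
  apply: (derive_lincomb oV Vx); [|exact: T_der..] => y Vy.
  exact: (blinPr (T_blin Vy)).
rewrite (_ : 'D_u (fun y => T y (c *: v + v') w) x =
  c *: 'D_u (fun y => T y v w) x + 'D_u (fun y => T y v' w) x).
  by push_linear; apply/rowP => j; rewrite !mxE; ring.
apply: (derive_lincomb oV Vx); [|exact: T_der..] => y Vy.
exact: (blinPl (T_blin Vy)).
Qed.

(** Constant fields are not parallel, but the terms with [G x u v] that they bring satisfy the same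
    identity at [x] and cancel; likewise in the next lemmas. *)
Lemma cov2_skew : (forall y, V y -> skew_valued (g y) (T y)) ->
  skew_valued (g x) (cov2 T x u).
Proof.
move=> sk v w z; have Tx := has_cov_T (has_cov_cst v) (has_cov_cst w).
have Tx' := has_cov_T (has_cov_cst v) (has_cov_cst z).
have [_ E1] := is_derive_g Tx (has_cov_cst z).
have [_ E2] := is_deriveN (is_derive_g (has_cov_cst w) Tx').
have E := near_eq_derive u (near_open oV Vx (fun y Vy => sk y Vy v w z)).
have := etrans (esym E1) (etrans E E2); rewrite /= {E E1 E2}.
rewrite !(gDl (g_blin Vx)) !(gDr (g_blin Vx)) !(sk x Vx _ _ z) (sk x Vx v w); lra.
Qed.

Lemma cov2_anti_J : (forall y, V y -> anti_J (J y) (T y)) ->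
  anti_J (J x) (cov2 T x u).
Proof.
move=> aJ v w.
have L := has_cov_T (has_cov_cst v) (has_cov_J (has_cov_cst w)).
have R' := has_covN (has_cov_J (has_cov_T (has_cov_cst v) (has_cov_cst w))).
have := has_cov_unique (fun y Vy => aJ y Vy v w) L R'.
rewrite !(linD (J_lin Vx)) !(aJ x Vx) !opprD /= => /addIr/addIr //.
Qed.

Lemma cov2_diag : (forall y v, V y -> T y v v = 0) -> forall v, cov2 T x u v v = 0.
Proof.
move=> T0 v.
have L := has_cov_T (has_cov_cst v) (has_cov_cst v).
have alt y w w' : V y -> T y w w' = - T y w' w.
  by move=> Vy; apply: W1_alternating => //; [exact: T_blin|move=> ?; exact: T0].
have R' := has_cov_cst 0; rewrite (lin0 ((G_blin Vx).1 u)) in R'.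
have := has_cov_unique (fun y Vy => T0 y v Vy) L R'.
by rewrite /= (alt x v) // addrK.
Qed.

Lemma cov2_JJ : (forall y v w, V y -> T y (J y v) (J y w) = T y v w) ->
  forall v w, cov2 T x u (J x v) (J x w) = cov2 T x u v w.
Proof.
move=> TJ v w.
have L := has_cov_T (has_cov_J (has_cov_cst v)) (has_cov_J (has_cov_cst w)).
have R' := has_cov_T (has_cov_cst v) (has_cov_cst w).
have := has_cov_unique (fun y Vy => TJ y v w Vy) L R'.
by rewrite /= !TJ// => /addIr/addIr.
Qed.

(** The frame is not parallel, but differentiating its orthonormality makes the coefficients
    [g x (d i) (f j x)] skew, so the two sums in which the frame is differentiated cancel. *)
Lemma cov2_trace (I : finType) (f : I -> E -> E) :
  (forall i, derivable (f i) x u) ->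
  (forall y i j, V y -> g y (f i y) (f j y) = (i == j)%:R) ->
  (forall v, v = \sum_i g x v (f i x) *: f i x) ->
  (forall y, V y -> \sum_i T y (f i y) (f i y) = 0) ->
  \sum_i cov2 T x u (f i x) (f i x) = 0.
Proof.
move=> df on expand T0.
pose d i := 'D_u (f i) x + G x u (f i x).
have cf i : has_cov (f i) x u (d i) by [].
have dsk i j : g x (d i) (f j x) = - g x (f i x) (d j).
  have [_ E] := is_derive_g (cf i) (cf j).
  have := near_eq_derive u (near_open oV Vx (fun y Vy => on y i j Vy)).
  by rewrite E derive_cst => /eqP; rewrite addr_eq0 => /eqP.
have L i := has_cov_T (cf i) (cf i).
have T0' y : V y -> (\sum_i (fun y => T y (f i y) (f i y))) y = cst 0 y.
  by move=> Vy; rewrite fct_sumE T0.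
have R' := has_cov_cst 0; rewrite (lin0 ((G_blin Vx).1 u)) in R'.
have := has_cov_unique T0' (has_cov_sum _ L) R'.
rewrite !big_split /=.
have Tl := T_blin Vx.
have -> : \sum_i T x (d i) (f i x) =
    \sum_i \sum_j g x (d i) (f j x) *: T x (f j x) (f i x).
  apply: eq_bigr => i _; rewrite [in LHS](expand (d i)) (lin_sum (Tl.2 _)).
  by apply: eq_bigr => j _; rewrite (blinZl Tl).
have -> : \sum_i T x (f i x) (d i) =
    - \sum_i \sum_j g x (d i) (f j x) *: T x (f j x) (f i x).
  rewrite exchange_big -sumrN; apply: eq_bigr => i _.
  rewrite [in LHS](expand (d i)) (lin_sum (Tl.1 _)) -sumrN.
  by apply: eq_bigr => j _; rewrite (blinZr Tl) dsk scaleNr gC.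
by rewrite addrK.
Qed.

End Tensor.
End AtPoint.
Lemma cov2_direction (T : E -> E -> E -> E) x v w : V x ->
  smooth_on V (fun y => T y v w) -> blin (T x) ->
  linear (fun u => cov2 T x u v w).
Proof.
move=> Vx sT Tl c u u'; have Gl := G_blin Vx.
have /= E := smooth_derive_linear oV Vx sT c u u'.
by rewrite /cov2 {}E; push_linear; rewrite !scalerBr !scalerDr -!addrA; congr (_ + _);
  apply/rowP => j; rewrite !mxE; ring.
Qed.

(** * The exterior derivative of the Kähler form in a chart *)

Section ThreeForm.
Variables (x : E) (T1 T3 : E -> E -> E -> E) (ts : E -> E) (th : E -> E -> R).
Hypothesis Vx : V x.
Hypothesis T1_blin : forall y, V y -> blin (T1 y).
Hypothesis T1_der : forall y u v w, V y -> derivable (fun z => T1 z v w) y u.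
Hypothesis T3_blin : forall y, V y -> blin (T3 y).
Hypothesis T3_der : forall y u v w, V y -> derivable (fun z => T3 z v w) y u.
Hypothesis th_der : forall y u v, V y -> derivable (fun z => th z v) y u.
Hypothesis th_ts : forall y v, V y -> g y (ts y) v = th y v.

Definition cov1 u v := 'D_u (fun y => th y v) x - th x (G x u v).

Lemma is_derive_form T u X Y Z : (forall y, V y -> blin (T y)) ->
  (forall y u v w, V y -> derivable (fun z => T z v w) y u) ->
  is_derive x u (fun y => g y (T y X Y) (J y Z))
    (g x (cov2 T x u X Y) (J x Z) + g x (T x (G x u X) Y) (J x Z) +
     g x (T x X (G x u Y)) (J x Z) + g x (T x X Y) (J x (G x u Z))).
Proof.
move=> Tl Td.
have D := is_derive_g Vx (has_cov_T Vx Tl Td (has_cov_cst x u X) (has_cov_cst x u Y))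
  (has_cov_J Vx (has_cov_cst x u Z)).
by apply: is_derive_eq D _; rewrite !(gDl (g_blin Vx)).
Qed.

Lemma is_derive_th u X : is_derive x u (fun y => g y (ts y) X)
  (cov1 u X + g x (ts x) (G x u X)).
Proof.
apply: near_eq_is_derive (_ : is_derive x u (fun y => th y X) _).
  by apply: (near_open oV Vx) => y Vy; rewrite th_ts.
by rewrite /cov1 th_ts// subrK; apply: derivableP; exact: th_der.
Qed.

Lemma is_derive_kahler u Y Z : is_derive x u (fun y => g y Y (J y Z))
  (g x (G x u Y) (J x Z) + g x Y (J x (G x u Z))).
Proof.
exact: (is_derive_g Vx (has_cov_cst x u Y) (has_cov_J Vx (has_cov_cst x u Z))).
Qed.

Lemma is_derive_domega u X Y Z :
  let om := domega (g x) (J x) (ts x) (T1 x) (T3 x) in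
  is_derive x u (fun y => domega (g y) (J y) (ts y) (T1 y) (T3 y) X Y Z)
    (Ddomega (g x) (J x) (cov2 T1 x) (cov2 T3 x) cov1 u X Y Z +
     om (G x u X) Y Z + om X (G x u Y) Z + om X Y (G x u Z)).
Proof.
move=> om.
have F1 A B C := is_derive_form u A B C T1_blin T1_der.
have F3 A B C := is_derive_form u A B C T3_blin T3_der.
have W A B C := is_derive_mulf (is_derive_th u A) (is_derive_kahler u B C).
have D := is_derive_addf (is_derive_addf (is_derive_cstmulf 6 (F1 X Y Z))
  (is_derive_cstmulf 2 (is_derive_addf (is_derive_addf (F3 X Y Z) (F3 Y Z X)) (F3 Z X Y))))
  (is_derive_addf (is_derive_addf (W X Y Z) (W Y Z X)) (W Z X Y)).
apply: is_derive_eq D _; rewrite /om /Ddomega /domega /domega_W1 /domega_W3 /domega_W4.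
ring.
Qed.

(** By the first assumption the cyclic sum of derivatives of [omega] equals [domega] on all of [V],
    so it may be differentiated once more, and [d_squared] applies. *)
Lemma domega_closed X Y Z W :
  (forall y A B C, V y ->
    g y (G y A B) (J y C) + g y B (J y (G y A C)) +
    (g y (G y B C) (J y A) + g y C (J y (G y B A))) +
    (g y (G y C A) (J y B) + g y A (J y (G y C B))) =
    domega (g y) (J y) (ts y) (T1 y) (T3 y) A B C) ->
  (forall y u v, V y -> g y u (J y v) = - g y v (J y u)) ->
  (forall u v, Ck_on V 2 (fun y => g y u (J y v))) ->
  let om := domega (g x) (J x) (ts x) (T1 x) (T3 x) in
  let Dom u X Y Z := Ddomega (g x) (J x) (cov2 T1 x) (cov2 T3 x) cov1 u X Y Z +
     om (G x u X) Y Z + om X (G x u Y) Z + om X Y (G x u Z) in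
  Dom X Y Z W - Dom Y X Z W + Dom Z X Y W - Dom W X Y Z = 0.
Proof.
move=> omE omsk omC om Dom.
pose w u v y := g y u (J y v).
have dwE y A B C : V y -> 'D_A (w B C) y + 'D_B (w C A) y + 'D_C (w A B) y =
    domega (g y) (J y) (ts y) (T1 y) (T3 y) A B C.
  move=> Vy; rewrite -(omE y A B C Vy).
  have D u v c : 'D_u (w v c) y = g y (G y u v) (J y c) + g y v (J y (G y u c)).
    by have [] := is_derive_g Vy (has_cov_cst y u v) (has_cov_J Vy (has_cov_cst y u c)).
  by rewrite !D.
have Ddw u A B C :
    'D_u (fun y => 'D_A (w B C) y + 'D_B (w C A) y + 'D_C (w A B) y) x = Dom u A B C.
  have [_ E'] := is_derive_domega u A B C; apply: etrans _ E'.
  by apply: near_eq_derive; apply: (near_open oV Vx) => y; exact: dwE.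
rewrite -!Ddw; exact: (d_squared X Y Z W oV Vx omC (fun u v y Vy => omsk y u v Vy)).
Qed.

End ThreeForm.

End ParallelStructure.

(** * Almost Hermitian manifolds *)

Lemma Ck_on_sub (R : realType) (U W : normedModType R) (V V' : set U) k (f : U -> W) :
  V' `<=` V -> Ck_on V k f -> Ck_on V' k f.
Proof.
move=> VV'; elim: k f => [|k IH] f [cf df]; (split; first by move=> y /VV'/cf) => //.
by move=> v; have [dfv Cv] := df v; split; [move=> y /VV'/dfv|exact: IH].
Qed.

Lemma open_img (R : realType) m (M : smoothManifold R m) (a : chart M) (W : set M) :
  open W -> open (img a W).
Proof.
move=> oW; rewrite openE => _ [p [ap Wp] <-].
have Ip : (cmap a @` dom a) (cmap a p) by exists p.
have nI : nbhs (cmap a p) (cmap a @` dom a).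
  by apply: open_nbhs_nbhs; split => //; exact: img_open.
have nW : nbhs (cinv a (cmap a p)) W.
  by rewrite cmapK//; apply: open_nbhs_nbhs.
have := cinv_continuous Ip nW; rewrite nbhs_filterE => nC.
apply: filterS (filterI nI nC) => _ [[q aq <-] /=]; rewrite /= cmapK// => Wq.
by exists q.
Qed.

(** Pairing [c *m P] with [e j] recovers [c 0 j], so the square matrix [P] with rows [e i] has no
    kernel and is invertible: the [e i] span. *)
Lemma orthonormal_expand (R : realType) m (h : 'rV[R]_m -> 'rV[R]_m -> R)
    (e : 'I_m -> 'rV[R]_m) :
  blin (h : _ -> _ -> R^o) -> (forall i j, h (e i) (e j) = (i == j)%:R) ->
  forall v, v = \sum_i h v (e i) *: e i.
Proof.
move=> hl on v.
pose P : 'M[R]_m := \matrix_(i, j) e i 0 j.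
have PE (c : 'rV[R]_m) : c *m P = \sum_i c 0 i *: e i.
  by apply/rowP => j; rewrite !mxE summxE; apply: eq_bigr => i _; rewrite !mxE.
have hP (c : 'rV[R]_m) j : h (c *m P) (e j) = c 0 j.
  rewrite PE (lin_sum (hl.2 _)) (bigD1 j)//= (gZl hl) on eqxx mulr1 big1 ?addr0//.
  by move=> i ij; rewrite (gZl hl) on (negPf ij) mulr0.
have Pu : P \in unitmx.
  rewrite -row_free_unit -kermx_eq0; apply/eqP/row_matrixP => i; rewrite row0.
  have := mulmx_ker P => /(congr1 (row i)); rewrite row_mul row0 => r0.
  by apply/rowP => j; rewrite -hP r0 (lin0 (hl.2 _)) mxE.
rewrite -[v in LHS](mulmxKV Pu) PE; apply: eq_bigr => i _; congr (_ *: _).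
by rewrite -hP mulmxKV.
Qed.

(** * The data of the theorem read in one chart *)

Section ChartOfAlmostHermitian.
Context (R : realType) (n : nat) (M : almostHermitian R n).
Variables (nabla : field12 M) (theta : field01 M) (thetas : vfield M).
Variables (xi1 xi2 xi3 xi4 : field12 M) (W : set M).
Variable frame : 'I_(n.*2) -> vfield M.
Hypothesis n1 : (1 < n)%N.
Hypothesis hnabla : is_levi_civita (@metric R n M) nabla.
Hypothesis htheta : is_lee_form nabla theta.
Hypothesis hthetas : is_sharp theta thetas.
Hypothesis hxi : is_torsion_decomposition nabla xi1 xi2 xi3 xi4.
Hypothesis hW : open W.
Hypothesis hframe : is_orthonormal_frame W frame.
Variable a : chart M.

Local Notation E := 'rV[R]_(n.*2).
Local Notation V := (img a W).
Local Notation g := (@metric R n M a).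
Local Notation J := (@acs R n M a).
Local Notation G := (minimal_connection nabla a).
Local Notation T y := (torsion_sum (xi1 a y) (xi2 a y) (xi3 a y) (xi4 a y)).
Local Notation e y := (fun i => frame i a y).

Let oV : open V := @open_img R _ M a W hW.

Lemma img_subT : V `<=` img a setT.
Proof. by move=> _ [p [ap _] <-]; exists p. Qed.

Let VT y : V y -> img a setT y := @img_subT y.

Lemma smooth_img (B : normedModType R) (f : E -> B) :
  smooth_on (img a setT) f -> smooth_on V f.
Proof. by move=> sf k; apply: Ck_on_sub (sf k); exact: img_subT. Qed.

Lemma derivable_img (B : normedModType R) (f : E -> B) y u :
  smooth_on (img a setT) f -> V y -> derivable f y u.
Proof. by move=> /smooth_img sf Vy; have [_ /(_ u)[+ _]] := sf 1%N; apply. Qed.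

Lemma g_lin y : V y -> blin (g y : E -> E -> R^o).
Proof. by move=> /VT; have [gl _ _] := metric_tensor M; exact: gl. Qed.

Lemma g_sym y u v : V y -> g y u v = g y v u.
Proof. by move=> /VT; exact: (@Defs.metric_sym R n M a). Qed.

Lemma g_derivable y u v w : V y -> derivable (fun z => g z v w) y u.
Proof. by have [_ gs _] := metric_tensor M; exact: derivable_img (gs a v w). Qed.

Lemma J_linear y : V y -> linear (J y).
Proof. by move=> /VT; have [Jl _ _] := acs_tensor M; exact: Jl. Qed.

Lemma J_derivable y u v : V y -> derivable (fun z => J z v) y u.
Proof. by have [_ Js _] := acs_tensor M; exact: derivable_img (Js a v). Qed.

Lemma JK y v : V y -> J y (J y v) = - v.
Proof. by move=> /VT; exact: (@acs_sqr R n M a). Qed.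

Lemma g_J y u v : V y -> g y (J y u) (J y v) = g y u v.
Proof. by move=> /VT; exact: (@metric_acs R n M a). Qed.

Lemma tensor12_lin X y : is_tensor12 X -> V y -> blin (X a y).
Proof. by move=> [Xl _ _] /VT; exact: Xl. Qed.

Lemma tensor12_derivable X y u v w : is_tensor12 X -> V y ->
  derivable (fun z => X a z v w) y u.
Proof. by move=> [_ Xs _]; exact: derivable_img (Xs a v w). Qed.

Lemma tensor12_smooth X v w : is_tensor12 X -> smooth_on V (fun z => X a z v w).
Proof. by move=> [_ Xs _]; exact: smooth_img (Xs a v w). Qed.

Lemma xi_tensor : [/\ is_tensor12 xi1, is_tensor12 xi2, is_tensor12 xi3 &
  is_tensor12 xi4].
Proof. by have [? ? ? ? _] := hxi. Qed.

Lemma xi_in y : V y -> [/\ in_W1 a y (xi1 a y), in_W2 a y (xi2 a y),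
  in_W3 a y (xi3 a y), in_W4 a y (xi4 a y) &
  forall u v, intrinsic_torsion nabla a y u v = T y u v].
Proof. by move=> /VT Iy; have [_ _ _ _ /(_ a y Iy)] := hxi. Qed.

Lemma in_W_facts y X : V y -> in_W a y X ->
  [/\ blin X, skew_valued (g y) X & anti_J (J y) X].
Proof.
move=> Vy [Xl Xs XJ]; split=> // u v; apply/eqP.
by rewrite -addr_eq0 addrC XJ.
Qed.

Lemma nabla_lin y : V y -> blin (nabla a y).
Proof. by move=> /VT; have [[nl _ _] _ _] := hnabla; exact: nl. Qed.

Lemma G_E y u v : V y -> G y u v = nabla a y u v + T y u v.
Proof. by move=> Vy; have [_ _ _ _ <-] := xi_in Vy. Qed.

Lemma torsion_sum_facts y : V y ->
  [/\ blin (T y), skew_valued (g y) (T y) & anti_J (J y) (T y)].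
Proof.
move=> Vy; have [[W1 _] [W2 _] [W3 _ _] [W4 _] _] := xi_in Vy.
have [? ? ?] := in_W_facts Vy W1; have [? ? ?] := in_W_facts Vy W2.
have [? ? ?] := in_W_facts Vy W3; have [? ? ?] := in_W_facts Vy W4.
split; first exact: torsion_sum_lin.
  by apply: torsion_sum_skew => //; exact: g_lin.
by apply: torsion_sum_anti_J => //; exact: J_linear.
Qed.

Lemma G_lin y : V y -> blin (G y).
Proof.
move=> Vy; have [Tl _ _] := torsion_sum_facts Vy; have nl := nabla_lin Vy.
have sl := blin_add nl Tl.
by split=> w c u v /=; rewrite !(G_E _ _ Vy); [exact: sl.1|exact: (sl.2 w)].
Qed.

Lemma metric_parallel y u v w : V y ->
  'D_u (fun z => g z v w) y - g y (G y u v) w - g y v (G y u w) = 0.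
Proof.
move=> Vy; have gl := g_lin Vy; have [_ Tsk _] := torsion_sum_facts Vy.
have [_ _ /(_ a y u v w (VT Vy))] := hnabla; rewrite /cov02 => par.
rewrite !(G_E _ _ Vy) (gDl gl) (gDr gl) Tsk -par; ring.
Qed.

Lemma cov_J y u v : V y -> cov11 nabla (@acs R n M) a y u v = 2 *: J y (T y u v).
Proof.
move=> Vy; have [_ _ _ _ <-] := xi_in Vy.
have Jl := J_linear Vy.
by rewrite /intrinsic_torsion (linZ Jl) (JK _ Vy) scalerN scaleNr opprK scalerA
  divff ?scale1r// pnatr_eq0.
Qed.

(** As [T u] anticommutes with [J], adding it to [nabla] changes the derivative of [J] by [- 2 J T],
    which cancels the value given by [cov_J]. *)
Lemma acs_parallel y u v : V y ->
  'D_u (fun z => J z v) y + G y u (J y v) - J y (G y u v) = 0.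
Proof.
move=> Vy; have [_ _ TJ] := torsion_sum_facts Vy; have Jl := J_linear Vy.
have := cov_J u v Vy; rewrite /cov11 !(G_E _ _ Vy) TJ (linD Jl (nabla _ _ _ _)) => C.
rewrite (_ : _ - _ = ('D_u (fun z => J z v) y + nabla a y u (J y v) -
  J y (nabla a y u v)) - 2 *: J y (T y u v)).
  by rewrite C subrr.
move: ('D_u _ y) (nabla a y u (J y v)) (J y (nabla a y u v)) (J y (T y u v)).
by move=> A B C' D; apply/rowP => j; rewrite !mxE; ring.
Qed.

Lemma sharp_E y v : V y -> g y (thetas a y) v = theta a y v.
Proof. by move=> /VT; have [_] := hthetas; apply. Qed.

Lemma theta_derivable y u v : V y -> derivable (fun z => theta a z v) y u.
Proof. by have [[_ ths _] _] := htheta; exact: derivable_img (ths a v). Qed.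

Lemma theta_linear y : V y -> linear (theta a y : E -> R^o).
Proof. by have [[thl _ _] _] := htheta; move=> /VT; exact: thl. Qed.

Lemma frame_orthonormal y : V y -> @Defs.orthonormal R n M a y (e y).
Proof. by have [_ on] := hframe; exact: on. Qed.

Lemma frame_expand y v : V y -> v = \sum_i g y v (frame i a y) *: frame i a y.
Proof.
by move=> Vy; exact: (orthonormal_expand (g_lin Vy) (frame_orthonormal Vy)).
Qed.

Lemma frame_trace y : V y ->
  \sum_i g y (frame i a y) (frame i a y) = 2 * n%:R.
Proof.
move=> Vy; under eq_bigr => i _ do rewrite (frame_orthonormal Vy) eqxx.
by rewrite sumr_const card_ord -mul2n natrM.
Qed.

Lemma frame_derivable i y u : V y -> derivable (frame i a) y u.
Proof.
by have [/(_ i)[fs _] _] := hframe; have [_ /(_ u)[+ _]] := fs a 1%N; apply.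
Qed.

Lemma derive_kahler y u v w : V y -> 'D_u (fun z => g z v (J z w)) y =
  g y (G y u v) (J y w) + g y v (J y (G y u w)).
Proof.
move=> Vy.
have cJ := has_cov_J oV J_linear J_derivable acs_parallel Vy (has_cov_cst G y u w).
by have [] := is_derive_g oV g_lin g_derivable metric_parallel Vy
  (has_cov_cst G y u v) cJ.
Qed.

Lemma cov_kahler y u v w : V y ->
  cov02 nabla (@kahler R n M) a y u v w = 2 * g y (T y u v) (J y w).
Proof.
move=> Vy; have gl := g_lin Vy; have Jl := J_linear Vy.
have [_ Tsk TJ] := torsion_sum_facts Vy.
rewrite /cov02 /kahler derive_kahler// !(G_E _ _ Vy).
rewrite (linD Jl (nabla _ _ _ _)) (gDl gl (nabla _ _ _ _)).
rewrite (gDr gl (J y (nabla _ _ _ _))) (Tsk _ v) TJ (gNr gl); ring.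
Qed.

Let nR1 : n%:R != 1 :> R.
Proof. by rewrite pnatr_eq1; case: (n) n1 => [|[]]. Qed.

Lemma theta_trace y v : V y ->
  (n%:R - 1) * theta a y v = 2 * g y (\sum_i T y (frame i a y) (frame i a y)) v.
Proof.
move=> Vy; have gl := g_lin Vy.
have [_ /(_ a y _ v (VT Vy) (frame_orthonormal Vy)) ->] := htheta.
rewrite /Jform /codiff mulrA (mulrN (n%:R - 1)) divff ?subr_eq0//.
rewrite opprK mulN1r (lin_sum (gl.2 v)) mulr_sumr -sumrN; apply: eq_bigr => i _.
by rewrite cov_kahler// JK// (gNr gl) mulrN opprK.
Qed.

(** [in_W4] provides the formula for some covector. The trace of the intrinsic torsion comes from W4
    alone, so comparing it with [theta_trace] identifies that covector with the Lee form, because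
    [n] is not [1]. *)
Lemma xi4E y : V y -> forall u v, 4 *: xi4 a y u v =
  g y u v *: thetas a y - g y (thetas a y) v *: u
  - g y (J y u) v *: J y (thetas a y) - g y (thetas a y) (J y v) *: J y u.
Proof.
move=> Vy; have gl := g_lin Vy.
have [[W1 x1d] [W2 x2c] [W3 x3J x3t] [W4 [th [ths [thE x4E]]]] _] := xi_in Vy.
have [l1 _ _] := in_W_facts Vy W1; have [l2 _ J2] := in_W_facts Vy W2.
have {}x4E u v : 4 *: xi4 a y u v = g y u v *: ths - g y ths v *: u
    - g y (J y u) v *: J y ths - g y ths (J y v) *: J y u.
  by rewrite x4E /Jform !thE scaleNr.
suff -> : thetas a y = ths by [].
apply: (g_inj (fun v => frame_expand v Vy)) => w; rewrite sharp_E//.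
have n10 : n%:R - 1 != 0 :> R by rewrite subr_eq0.
apply: (mulfI n10); rewrite theta_trace// -!(gZl gl); congr (g y _ w).
exact: (torsion_sum_trace gl (fun u v => g_sym u v Vy) (fun v => frame_expand v Vy) (J_linear Vy)
  (fun v => JK v Vy) (fun u v => g_J u v Vy) (frame_trace Vy) l2 J2 x1d x2c
  (x3t _ (frame_orthonormal Vy)) x4E).
Qed.

Lemma kahler_C2 u v : Ck_on V 2 (fun y => g y u (J y v)).
Proof.
have [_ gs _] := metric_tensor M; have [_ Js _] := acs_tensor M.
pose F j : E -> R := (fun y => J y v 0 j) * (fun y => g y u (delta_mx 0 j)).
apply: (@Ck_on_eq _ _ V oV _ _ (\sum_j F j)) => [y Vy|].
  by rewrite (lin_row _ ((g_lin Vy).1 u)) fct_sumE.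
apply: Ck_on_sum => // j; apply: Ck_onM => //.
  by apply: Ck_on_coord => //; exact: smooth_img.
exact: smooth_img.
Qed.

Lemma kahler_skew y u v : V y -> g y u (J y v) = - g y v (J y u).
Proof.
move=> Vy; rewrite -(g_J u (J y v) Vy) JK// (gNr (g_lin Vy)).
by rewrite (g_sym _ _ Vy).
Qed.

Lemma domega_at y A B C : V y ->
  g y (G y A B) (J y C) + g y B (J y (G y A C)) +
  (g y (G y B C) (J y A) + g y C (J y (G y B A))) +
  (g y (G y C A) (J y B) + g y A (J y (G y C B))) =
  domega (g y) (J y) (thetas a y) (xi1 a y) (xi3 a y) A B C.
Proof.
move=> Vy.
have [[W1 x1d] [W2 x2c] [W3 _ _] [W4 _] _] := xi_in Vy.
have [l1 s1 J1] := in_W_facts Vy W1; have [_ s2 J2] := in_W_facts Vy W2.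
have [_ s3 J3] := in_W_facts Vy W3; have [_ s4 J4] := in_W_facts Vy W4.
have nabla_sym u v : nabla a y u v = nabla a y v u.
  by have [_ + _] := hnabla; apply; exact: VT.
exact: (domegaE (g_lin Vy) (fun u v => g_sym u v Vy) (J_linear Vy)
  (fun v => JK v Vy) (fun u v => g_J u v Vy) l1 s1 s2 s3 s4 J1 J2 J3 J4
  x1d x2c (xi4E Vy) A B C (fun u v => G_E u v Vy) nabla_sym).
Qed.

Variable x : E.
Hypothesis Vx : V x.
Local Notation nablaU := (minimal_connection nabla).
Local Notation dth := (dform nabla theta a x).

Let xi_at := xi_in Vx.

(** Passing from [nabla] to the minimal connection subtracts [theta (T u v)] from the derivative of
    [theta]; the torsion term restores it. *)
Lemma dform_torsion u v : dth u v =
  cov1 G x (theta a) u v - cov1 G x (theta a) v u +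
  g x (thetas a x) (torsion (xi1 a x) (xi2 a x) (xi3 a x) (xi4 a x) u v).
Proof.
have tl := theta_linear Vx.
rewrite /dform /cov01 /cov1 /torsion !(G_E _ _ Vx) !(linD tl (nabla _ _ _ _)).
by rewrite sharp_E// (linB tl); ring.
Qed.

Lemma cov1_lin : blin (cov1 G x (theta a) : E -> E -> R^o).
Proof.
have tl := theta_linear Vx; have Gl := G_lin Vx.
have [[thl ths _] _] := htheta.
split=> w c u v; rewrite /cov1.
  rewrite (@derive_lincomb R _ _ V _ (fun y => theta a y u) (fun y => theta a y v) c)//.
  - by rewrite (blinPr Gl) tl /GRing.scale /=; ring.
  - by move=> y Vy; exact: theta_linear.
  - exact: theta_derivable.
  - exact: theta_derivable.
have st := smooth_img (ths a w).
rewrite (smooth_deriveD oV st _ _ Vx) (smooth_deriveZ st _ _ Vx).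
by rewrite (blinPl Gl) tl /GRing.scale /=; ring.
Qed.

Lemma chart_components u v :
  [/\ \sum_i \sum_j dth (frame i a x) (frame j a x) *
        g x (frame i a x) (J x (frame j a x)) = 0,
      (n%:R - 2) / 2 * (2^-1 * (dth u v + dth (J x u) (J x v))) =
        - (\sum_i g x (cov12 nablaU xi3 a x (frame i a x) u v) (frame i a x))
        + \sum_i g x (cov12 nablaU xi3 a x (frame i a x) v u) (frame i a x)
        + (n%:R - 2) / 2 * g x (xi3 a x u v - xi3 a x v u) (thetas a x)
        - 3 / 2 * (\sum_i g x (xi1 a x u (frame i a x)) (xi2 a x v (frame i a x)))
        + 3 / 2 * (\sum_i g x (xi1 a x v (frame i a x)) (xi2 a x u (frame i a x)))
    & (n%:R - 2) / 2 * (2^-1 * (dth u v - dth (J x u) (J x v))) =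
        - 3 * (\sum_i g x (cov12 nablaU xi1 a x (frame i a x) (frame i a x) u) v)
        + \sum_i g x (cov12 nablaU xi3 a x (frame i a x) (frame i a x) u) v
        + \sum_i g x (xi3 a x u (frame i a x)) (xi1 a x v (frame i a x))
        - \sum_i g x (xi3 a x v (frame i a x)) (xi1 a x u (frame i a x))
        - 1 / 2 * (\sum_i g x (xi3 a x u (frame i a x)) (xi2 a x v (frame i a x)))
        + 1 / 2 * (\sum_i g x (xi3 a x v (frame i a x)) (xi2 a x u (frame i a x)))
        + 3 * (n%:R - 3) / 2 * g x (xi1 a x (thetas a x) u) v
        - (n%:R - 1) / 2 * g x (xi3 a x (thetas a x) u) v ].
Proof.
have [t1 t2 t3 t4] := xi_tensor.
have [[W1 x1d] [W2 x2c] [W3 x3J x3t] [W4 _] _] := xi_at.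
have [l1 s1 J1] := in_W_facts Vx W1; have [l2 s2 J2] := in_W_facts Vx W2.
have [l3 s3 J3] := in_W_facts Vx W3; have [l4 s4 J4] := in_W_facts Vx W4.
have L1 y (Vy : V y) : blin (xi1 a y) := tensor12_lin t1 Vy.
have L3 y (Vy : V y) : blin (xi3 a y) := tensor12_lin t3 Vy.
have d1 y z w w' (Vy : V y) := @tensor12_derivable xi1 y z w w' t1 Vy.
have d3 y z w w' (Vy : V y) := @tensor12_derivable xi3 y z w w' t3 Vy.
have F1 y : V y -> [/\ skew_valued (g y) (xi1 a y), anti_J (J y) (xi1 a y) &
    forall w, xi1 a y w w = 0].
  by move=> Vy; have [[+ dg] _ _ _ _] := xi_in Vy => /(in_W_facts Vy)[].
have F3 y : V y -> [/\ skew_valued (g y) (xi3 a y), anti_J (J y) (xi3 a y),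
    forall w w', xi3 a y (J y w) (J y w') = xi3 a y w w' &
    \sum_i xi3 a y (frame i a y) (frame i a y) = 0].
  move=> Vy; have [_ _ [+ xJ xt] _ _] := xi_in Vy => /(in_W_facts Vy)[_ sk aJ].
  by split=> //; exact: xt (frame_orthonormal Vy).
have closed X Y Z U := closed_of_derivative (g_lin Vx) (fun u v => g_sym u v Vx)
  (J_linear Vx) (fun v => JK v Vx) (fun u v => g_J u v Vx) l1 l3 s1 s3 J1 J3 x1d
  (fun u v => G_E u v Vx)
  (fun u v => let: And3 _ s _ := hnabla in s a x u v (VT Vx))
  (domega_closed oV g_lin g_derivable metric_parallel J_linear J_derivable
    acs_parallel Vx L1 d1 L3 d3 theta_derivable sharp_E X Y Z U domega_at
    kahler_skew kahler_C2).
have := lee_differential_components (g_lin Vx) (fun u v => g_sym u v Vx)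
  (fun v => frame_expand v Vx) (J_linear Vx) (fun v => JK v Vx)
  (fun u v => g_J u v Vx) (frame_trace Vx) l1 l2 l3 l4 s1 s2 s3 s4 J1 J2 J3 J4
  x1d x2c x3J (x3t _ (frame_orthonormal Vx)) (xi4E Vx)
  (fun u => cov2_blin oV G_lin u Vx L1 d1) (fun u => cov2_blin oV G_lin u Vx L3 d3)
  (fun v w => cov2_direction oV G_lin Vx (tensor12_smooth v w t1) l1)
  (fun v w => cov2_direction oV G_lin Vx (tensor12_smooth v w t3) l3)
  (fun u => cov2_skew oV g_lin g_derivable metric_parallel u Vx L1 d1
    (fun y Vy => let: And3 s _ _ := F1 y Vy in s))
  (fun u => cov2_skew oV g_lin g_derivable metric_parallel u Vx L3 d3
    (fun y Vy => let: And4 s _ _ _ := F3 y Vy in s))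
  (fun u => cov2_anti_J oV J_linear J_derivable acs_parallel G_lin u Vx L1 d1
    (fun y Vy => let: And3 _ s _ := F1 y Vy in s))
  (fun u => cov2_anti_J oV J_linear J_derivable acs_parallel G_lin u Vx L3 d3
    (fun y Vy => let: And4 _ s _ _ := F3 y Vy in s))
  (fun u => cov2_diag oV G_lin u Vx L1 d1
    (fun y w Vy => let: And3 _ _ s := F1 y Vy in s w))
  (fun u => cov2_JJ oV J_linear J_derivable acs_parallel u Vx L3 d3
    (fun y w w' Vy => let: And4 _ _ s _ := F3 y Vy in s w w'))
  (fun u => cov2_trace (f := fun i => frame i a) oV g_lin g_sym g_derivable
    metric_parallel G_lin Vx L3 d3 (fun i => @frame_derivable i x u Vx)
    (fun y i j Vy => frame_orthonormal Vy i j) (fun v => frame_expand v Vx)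
    (fun y Vy => let: And4 _ _ _ s := F3 y Vy in s))
  cov1_lin closed u v nR1.
move=> [E0 E11 E20]; split.
- rewrite -[RHS]E0; apply: eq_bigr => i _; apply: eq_bigr => j _.
  by rewrite dform_torsion.
- by rewrite !dform_torsion; exact: E11.
- by rewrite !dform_torsion; exact: E20.
Qed.

End ChartOfAlmostHermitian.

Theorem proposition3p4 (R : realType) (n : nat) (hn : (1 < n)%N)
  (M : almostHermitian R n)
  (nabla : field12 M) (hnabla : is_levi_civita (@metric R n M) nabla)
  (theta : field01 M) (htheta : is_lee_form nabla theta)
  (thetas : vfield M) (hthetas : is_sharp theta thetas)
  (xi1 xi2 xi3 xi4 : field12 M)
  (hxi : is_torsion_decomposition nabla xi1 xi2 xi3 xi4)
  (W : set M) (hW : open W)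
  (frame : 'I_(n.*2) -> vfield M) (hframe : is_orthonormal_frame W frame)
  (X Y : vfield M) (hX : is_vector_field W X) (hY : is_vector_field W Y)
  (a : chart M) (x : 'rV[R]_(n.*2)) (hx : img a W x) :
  let g := metric a x in
  let e i := frame i a x in
  let u := X a x in
  let v := Y a x in
  let th := thetas a x in
  let dth := dform nabla theta a x in
  let nablaU := minimal_connection nabla in
  [/\ comp_Romega a x e dth u v = 0,
      (n%:R - 2) / 2 * comp_110 a x e dth u v =
        - (\sum_i g (cov12 nablaU xi3 a x (e i) u v) (e i))
        + \sum_i g (cov12 nablaU xi3 a x (e i) v u) (e i)
        + (n%:R - 2) / 2 * g (xi3 a x u v - xi3 a x v u) th
        - 3 / 2 * (\sum_i g (xi1 a x u (e i)) (xi2 a x v (e i)))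
        + 3 / 2 * (\sum_i g (xi1 a x v (e i)) (xi2 a x u (e i)))
    & (n%:R - 2) / 2 * comp_20 a x dth u v =
        - 3 * (\sum_i g (cov12 nablaU xi1 a x (e i) (e i) u) v)
        + \sum_i g (cov12 nablaU xi3 a x (e i) (e i) u) v
        + \sum_i g (xi3 a x u (e i)) (xi1 a x v (e i))
        - \sum_i g (xi3 a x v (e i)) (xi1 a x u (e i))
        - 1 / 2 * (\sum_i g (xi3 a x u (e i)) (xi2 a x v (e i)))
        + 1 / 2 * (\sum_i g (xi3 a x v (e i)) (xi2 a x u (e i)))
        + 3 * (n%:R - 3) / 2 * g (xi1 a x th u) v
        - (n%:R - 1) / 2 * g (xi3 a x th u) v ].
Proof.
have [E0 E11 E20] := chart_components hn hnabla htheta hthetas hxi hW hframe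
  hx (X a x) (Y a x).
move=> g e u v th dth nablaU.
have R0 p q : comp_Romega a x e dth p q = 0.
  by rewrite /comp_Romega /form2_inner E0 !mulr0 mul0r.
split; first exact: R0.
  by rewrite /comp_110 R0 subr0; exact: E11.
exact: E20.
Qed.
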